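(* Let $\mathcal{X}\subseteq\mathbb{R}^m$ and $\mathcal{Y}\subseteq\mathbb{R}^n$ be nonempty polytopes, $\mathcal{Z}=\mathcal{X}\times\mathcal{Y}\neq\{0\}$, and let $A\in\mathbb{R}^{m\times n}$, $A\ne0$, satisfy $\max_{x\in\mathcal{X}}\|A^\top x\|_\infty\le1$, $\max_{y\in\mathcal{Y}}\|Ay\|_\infty\le1$ and $\max_{i,j}|A_{ij}|\le1$. Fix any $\mu_{\mathrm{init}}>0$, $\eta_{\mathrm{init}}>0$ and $(x_{\mathrm{init}},y_{\mathrm{init}})\in\mathcal{Z}$. Then for every target accuracy $\varepsilon>0$ the algorithm Adaptive-$\mu$ AsymP-GDA described in the context terminates and returns a strategy profile $(x,y)\in\mathcal{Z}$ with $\mathrm{NashConv}(x,y)\le\varepsilon$, after at most $\mathcal{O}(\ln(1/\varepsilon))$ iterations in total; that is, there is a constant $C>0$, independent of $\varepsilon$ (it may depend on $A,\mathcal{X},\mathcal{Y},\mu_{\mathrm{init}},\eta_{\mathrm{init}}$ and the initial point), such that for all $\varepsilon\in(0,1/2]$ the total number of inner-loop iterations, summed over all subroutine calls, is at most $C\ln(1/\varepsilon)$.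
   Context: A polytope is a bounded polyhedron. $\|\cdot\|$ is the Euclidean norm for vectors, $\|A\|$ the largest singular value, $\Pi_S$ the Euclidean projection onto $S$. $\mathrm{NashConv}(x,y)=\max_{\tilde y\in\mathcal{Y}}x^\top A\tilde y-\min_{\tilde x\in\mathcal{X}}\tilde x^\top Ay$. Algorithm (Adaptive-$\mu$ AsymP-GDA), with input $\varepsilon$. Set $\eta_0=\eta_{\mathrm{init}}$, $(\hat x_x^{0},\hat y_x^{0})=(\hat x_y^{0},\hat y_y^{0})=(x_{\mathrm{init}},y_{\mathrm{init}})$. For episodes $k=1,2,\dots$: let $\mu_k=\mu_{\mathrm{init}}/2^{k-1}$, $\eta_k=\min\left(\eta_{k-1},\frac{\mu_k}{\mu_k^2+mn}\right)$, $\delta_k=\frac{\mu_k}{2\|A\|^2\max_{z\in\mathcal{Z}}\|z\|^2}\varepsilon^2$; compute $(\hat x_x^{k},\hat y_x^{k})=\textsc{AsymP-GDA}_x(\hat x_x^{k-1},\hat y_x^{k-1},\eta_k,\mu_k,\delta_k)$ and $(\hat x_y^{k},\hat y_y^{k})=\textsc{AsymP-GDA}_y(\hat x_y^{k-1},\hat y_y^{k-1},\eta_k,\mu_k,\delta_k)$; if $\max_{x\in\mathcal{X}}\langle A\hat y_y^{k},\hat x_x^{k}-x\rangle+\max_{y\in\mathcal{Y}}\langle-A^\top\hat x_x^{k},\hat y_y^{k}-y\rangle\le\varepsilon$, return $(\hat x_x^{k},\hat y_y^{k})$ and stop. Subroutine $\textsc{AsymP-GDA}_x(x^1,y^1,\eta,\mu,\delta)$: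 for $t=1,2,\dots$ set $x^{t+1}=\Pi_{\mathcal{X}}(x^t-\eta(Ay^t+\mu x^t))$, then $y^{t+1}=\Pi_{\mathcal{Y}}(y^t+\eta A^\top x^{t+1})$; if $\max_{x\in\mathcal{X}}\langle Ay^{t+1}+\mu x^{t+1},x^{t+1}-x\rangle+\max_{y\in\mathcal{Y}}\langle-A^\top x^{t+1},y^{t+1}-y\rangle\le\delta$, return $(x^{t+1},y^{t+1})$. Subroutine $\textsc{AsymP-GDA}_y(x^1,y^1,\eta,\mu,\delta)$: for $t=1,2,\dots$ set $y^{t+1}=\Pi_{\mathcal{Y}}(y^t+\eta(A^\top x^t-\mu y^t))$, then $x^{t+1}=\Pi_{\mathcal{X}}(x^t-\eta Ay^{t+1})$; if $\max_{x\in\mathcal{X}}\langle Ay^{t+1},x^{t+1}-x\rangle+\max_{y\in\mathcal{Y}}\langle-A^\top x^{t+1}+\mu y^{t+1},y^{t+1}-y\rangle\le\delta$, return $(x^{t+1},y^{t+1})$. Each pass $t$ of a subroutine loop counts as one iteration. *)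

(* Defs.v *)
From mathcomp Require Import all_boot all_order all_algebra.
From mathcomp Require Import all_classical all_reals all_analysis.

Set Implicit Arguments.
Unset Strict Implicit.
Unset Printing Implicit Defensive.

Import Order.TTheory GRing.Theory Num.Theory.
Import numFieldNormedType.Exports.

Local Open Scope classical_set_scope.
Local Open Scope ring_scope.

(* Vectors of R^d are columns 'cV[R]_d.  The library norm `|v| on matrices is
   the max norm; the Euclidean one is [l2norm].  Maxima and minima over the
   compact strategy sets are written [sup] and [inf]. *)

Definition dotv (R : realType) d (u v : 'cV[R]_d) : R :=
  \sum_(i < d) u i 0 * v i 0.

Definition l2norm (R : realType) d (v : 'cV[R]_d) : R :=
  Num.sqrt (\sum_(i < d) v i 0 ^+ 2).

(* Largest singular value.  The singular values are taken to be the square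
   roots of the eigenvalues of A^T A: compared with A A^T, this can only add
   or remove the value 0, which does not change the maximum. *)
Definition specnorm (R : realType) m n (A : 'M[R]_(m, n)) : R :=
  sup [set Num.sqrt a | a in [set a | eigenvalue (A^T *m A) a]].

Definition polyhedron (R : realType) d (S : set 'cV[R]_d) : Prop :=
  exists (k : nat) (B : 'M[R]_(k, d)) (b : 'cV[R]_k),
    S = [set v | forall i, (B *m v) i 0 <= b i 0].

Definition polytope (R : realType) d (S : set 'cV[R]_d) : Prop :=
  polyhedron S /\ bounded_set S.

Definition is_proj (R : realType) d (S : set 'cV[R]_d) (v p : 'cV[R]_d) :=
  S p /\ forall q, S q -> l2norm (v - p) <= l2norm (v - q).

(* Nearest point of S; it exists and is unique when S is nonempty, closed and
   convex, and the default value 0 is then irrelevant. *)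
Definition proj (R : realType) d (S : set 'cV[R]_d) (v : 'cV[R]_d) : 'cV[R]_d :=
  xget 0 [set p | is_proj S v p].

(* X x Y as a subset of R^(m+n), z = (x, y) being stacked as col_mx x y. *)
Definition profiles (R : realType) m n (X : set 'cV[R]_m) (Y : set 'cV[R]_n) :
    set 'cV[R]_(m + n) :=
  [set z | X (usubmx z) /\ Y (dsubmx z)].

Definition nashconv (R : realType) m n (A : 'M[R]_(m, n))
    (X : set 'cV[R]_m) (Y : set 'cV[R]_n) (x : 'cV[R]_m) (y : 'cV[R]_n) : R :=
  sup [set dotv x (A *m y') | y' in Y] - inf [set dotv x' (A *m y) | x' in X].

(* max_{x' in X} <gx, x - x'> + max_{y' in Y} <gy, y - y'>, the quantity tested
   by all the stopping rules. *)
Definition vi_gap (R : realType) m n (X : set 'cV[R]_m) (Y : set 'cV[R]_n)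
    (gx : 'cV[R]_m) (gy : 'cV[R]_n) (x : 'cV[R]_m) (y : 'cV[R]_n) : R :=
  sup [set dotv gx (x - x') | x' in X] + sup [set dotv gy (y - y') | y' in Y].

(* [repeat_until step stop s N s']: the loop "s := step s until stop s",
   entered in state s, terminates after exactly N passes in state s'. *)
Inductive repeat_until (T : Type) (step : T -> T) (stop : T -> Prop) :
    T -> nat -> T -> Prop :=
| repeat_stop s : stop (step s) -> repeat_until step stop s 1 (step s)
| repeat_next s N s' : ~ stop (step s) ->
    repeat_until step stop (step s) N s' -> repeat_until step stop s N.+1 s'.

Definition stepx (R : realType) m n (A : 'M[R]_(m, n))
    (X : set 'cV[R]_m) (Y : set 'cV[R]_n) (eta mu : R)
    (z : 'cV[R]_m * 'cV[R]_n) : 'cV[R]_m * 'cV[R]_n :=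
  let x := proj X (z.1 - eta *: (A *m z.2 + mu *: z.1)) in
  let y := proj Y (z.2 + eta *: (A^T *m x)) in
  (x, y).

Definition stopx (R : realType) m n (A : 'M[R]_(m, n))
    (X : set 'cV[R]_m) (Y : set 'cV[R]_n) (mu delta : R)
    (z : 'cV[R]_m * 'cV[R]_n) : Prop :=
  vi_gap X Y (A *m z.2 + mu *: z.1) (- (A^T *m z.1)) z.1 z.2 <= delta.

(* [asymp_gda_x A X Y eta mu delta z N z']: AsymP-GDA_x started at z returns z'
   after N iterations. *)
Definition asymp_gda_x (R : realType) m n (A : 'M[R]_(m, n))
    (X : set 'cV[R]_m) (Y : set 'cV[R]_n) (eta mu delta : R) :=
  repeat_until (stepx A X Y eta mu) (stopx A X Y mu delta).

Definition stepy (R : realType) m n (A : 'M[R]_(m, n))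
    (X : set 'cV[R]_m) (Y : set 'cV[R]_n) (eta mu : R)
    (z : 'cV[R]_m * 'cV[R]_n) : 'cV[R]_m * 'cV[R]_n :=
  let y := proj Y (z.2 + eta *: (A^T *m z.1 - mu *: z.2)) in
  let x := proj X (z.1 - eta *: (A *m y)) in
  (x, y).

Definition stopy (R : realType) m n (A : 'M[R]_(m, n))
    (X : set 'cV[R]_m) (Y : set 'cV[R]_n) (mu delta : R)
    (z : 'cV[R]_m * 'cV[R]_n) : Prop :=
  vi_gap X Y (A *m z.2) (- (A^T *m z.1) + mu *: z.2) z.1 z.2 <= delta.

Definition asymp_gda_y (R : realType) m n (A : 'M[R]_(m, n))
    (X : set 'cV[R]_m) (Y : set 'cV[R]_n) (eta mu delta : R) :=
  repeat_until (stepy A X Y eta mu) (stopy A X Y mu delta).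

Definition mu_ep (R : realType) (mu_init : R) (k : nat) : R :=
  mu_init / 2 ^+ k.-1.

Definition eta_ep (R : realType) (m n : nat) (mu_init eta_prev : R) (k : nat) : R :=
  Num.min eta_prev
    (mu_ep mu_init k / (mu_ep mu_init k ^+ 2 + (m * n)%:R)).

Definition delta_ep (R : realType) m n (A : 'M[R]_(m, n))
    (X : set 'cV[R]_m) (Y : set 'cV[R]_n) (mu_init eps : R) (k : nat) : R :=
  mu_ep mu_init k
    / (2 * specnorm A ^+ 2 * sup [set l2norm z ^+ 2 | z in profiles X Y])
    * eps ^+ 2.

(* [adaptive_from A X Y mu_init eps k eta zx zy N x y]: resumed at the start of
   episode k with eta_{k-1} = eta, (x_x^{k-1}, y_x^{k-1}) = zx and
   (x_y^{k-1}, y_y^{k-1}) = zy, the algorithm terminates and returns (x, y),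
   having made N further inner iterations in total. *)
Inductive adaptive_from (R : realType) m n (A : 'M[R]_(m, n))
    (X : set 'cV[R]_m) (Y : set 'cV[R]_n) (mu_init eps : R) :
    nat -> R -> 'cV[R]_m * 'cV[R]_n -> 'cV[R]_m * 'cV[R]_n ->
    nat -> 'cV[R]_m -> 'cV[R]_n -> Prop :=
| adaptive_stop k eta zx zy Nx Ny zx' zy' :
    asymp_gda_x A X Y (eta_ep m n mu_init eta k) (mu_ep mu_init k)
      (delta_ep A X Y mu_init eps k) zx Nx zx' ->
    asymp_gda_y A X Y (eta_ep m n mu_init eta k) (mu_ep mu_init k)
      (delta_ep A X Y mu_init eps k) zy Ny zy' ->
    vi_gap X Y (A *m zy'.2) (- (A^T *m zx'.1)) zx'.1 zy'.2 <= eps ->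
    adaptive_from A X Y mu_init eps k eta zx zy (Nx + Ny) zx'.1 zy'.2
| adaptive_next k eta zx zy Nx Ny zx' zy' N x y :
    asymp_gda_x A X Y (eta_ep m n mu_init eta k) (mu_ep mu_init k)
      (delta_ep A X Y mu_init eps k) zx Nx zx' ->
    asymp_gda_y A X Y (eta_ep m n mu_init eta k) (mu_ep mu_init k)
      (delta_ep A X Y mu_init eps k) zy Ny zy' ->
    ~ vi_gap X Y (A *m zy'.2) (- (A^T *m zx'.1)) zx'.1 zy'.2 <= eps ->
    adaptive_from A X Y mu_init eps k.+1 (eta_ep m n mu_init eta k) zx' zy'
      N x y ->
    adaptive_from A X Y mu_init eps k eta zx zy (Nx + Ny + N) x y.

(* Adaptive-mu AsymP-GDA with target accuracy eps terminates and returns (x, y)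
   after N inner iterations in total. *)
Definition adaptive_asymp_gda (R : realType) m n (A : 'M[R]_(m, n))
    (X : set 'cV[R]_m) (Y : set 'cV[R]_n) (mu_init eta_init : R)
    (x_init : 'cV[R]_m) (y_init : 'cV[R]_n) (eps : R) :=
  adaptive_from A X Y mu_init eps 1 eta_init (x_init, y_init) (x_init, y_init).

(* Main.v *)
Require Import Defs.
From mathcomp Require Import all_boot all_order all_algebra.
From mathcomp Require Import all_classical all_reals all_analysis.
From mathcomp Require Import ring lra.
Import Order.TTheory GRing.Theory Num.Theory.
Import numFieldNormedType.Exports.
Local Open Scope classical_set_scope.
Local Open Scope ring_scope.

(** The number of passes in one subroutine call is logarithmic because the
alternating projected dynamics converges linearly to the saddle points of the
perturbed game [x^T A y + mu/2 |x|^2].  These exist and share their first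
component [xs] ([saddle_exists], [saddle_x_unique]).  A pass never moves away from any
of them, and the squared distance drops by a multiple of the squared residual,
made of the lengths of the two moves and of [x - xs] ([stepx_descent]).  Conversely
the residual controls the distance to the saddle points: a small residual means
that [y] almost satisfies the conditions for [(xs, y)] to be a saddle point
([stepx_residual]); over polytopes these reduce to finitely many linear
inequalities ([polytope_faces]), and Hoffman's bound ([hoffman]) says that a point which
almost satisfies such a system is proportionally close to a point which satisfies
it ([saddle_error_bound]).  Together this gives a contraction
([stepx_contraction]), with a rate that depends on the game, [mu] and [eta] only.
The tested gap is proportional to the distance, so a target of order [eps^2] is met
after O(ln (1/eps)) passes, uniformly in the starting point
([asymp_gda_x_linear]).  The other subroutine is the same one for the matrix
[- A^T] with the players exchanged ([asymp_gda_y_swap]).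

The number of episodes is bounded independently of [eps] because the perturbation
is exact.  The function [max_y x^T A y] is a maximum of finitely many linear
functions, so by Hoffman's bound it grows at least linearly with the distance to its
minimisers over [X], and a small enough quadratic term cannot pull the minimiser out of
that set ([exact_penalty]).  Once [mu] is that small, the limits of the two
subroutines are exact minimax strategies for the two players, whose values are
opposite by [minimax]; strong convexity turns the stopping thresholds into
distances to these strategies, and the threshold is tuned so that the resulting
profile has gap at most [eps] ([final_gap]). *)

Set Implicit Arguments.
Unset Strict Implicit.
Unset Printing Implicit Defensive.

(** * Euclidean geometry of column vectors *)

Section Euclid.
Context {R : realType}.
Implicit Types d m n : nat.

Lemma dotvC d (u v : 'cV[R]_d) : dotv u v = dotv v u.
Proof. by apply: eq_bigr => i _; rewrite mulrC. Qed.

Lemma dotvDl d (u v w : 'cV[R]_d) : dotv (u + v) w = dotv u w + dotv v w.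
Proof. by rewrite -big_split; apply: eq_bigr => i _; rewrite mxE mulrDl. Qed.

Lemma dotvZl d a (u w : 'cV[R]_d) : dotv (a *: u) w = a * dotv u w.
Proof. by rewrite mulr_sumr; apply: eq_bigr => i _; rewrite mxE mulrA. Qed.

Lemma dotvNl d (u w : 'cV[R]_d) : dotv (- u) w = - dotv u w.
Proof. by rewrite -scaleN1r dotvZl mulN1r. Qed.

Lemma dotvDr d (u v w : 'cV[R]_d) : dotv w (u + v) = dotv w u + dotv w v.
Proof. by rewrite dotvC dotvDl !(dotvC _ w). Qed.

Lemma dotvZr d a (u w : 'cV[R]_d) : dotv w (a *: u) = a * dotv w u.
Proof. by rewrite dotvC dotvZl dotvC. Qed.

Lemma dotvNr d (u w : 'cV[R]_d) : dotv w (- u) = - dotv w u.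
Proof. by rewrite dotvC dotvNl dotvC. Qed.

Lemma dotvBl d (u v w : 'cV[R]_d) : dotv (u - v) w = dotv u w - dotv v w.
Proof. by rewrite dotvDl dotvNl. Qed.

Lemma dotvBr d (u v w : 'cV[R]_d) : dotv w (u - v) = dotv w u - dotv w v.
Proof. by rewrite dotvDr dotvNr. Qed.

Lemma dotv0l d (w : 'cV[R]_d) : dotv 0 w = 0.
Proof. by rewrite -(scale0r 0) dotvZl mul0r. Qed.

Lemma dotv0r d (w : 'cV[R]_d) : dotv w 0 = 0.
Proof. by rewrite dotvC dotv0l. Qed.

Definition dotvE := (dotvBl, dotvBr, dotvDl, dotvDr, dotvNl, dotvNr, dotvZl, dotvZr).

Lemma dotv_mx d (u v : 'cV[R]_d) : dotv u v = (u^T *m v) 0 0.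
Proof. by rewrite mxE; apply: eq_bigr => i _; rewrite mxE. Qed.

Lemma dotv_mulmx m n (A : 'M[R]_(m, n)) x y :
  dotv x (A *m y) = dotv (A^T *m x) y.
Proof. by rewrite !dotv_mx trmx_mul trmxK mulmxA. Qed.

Lemma dotvv_ge0 d (v : 'cV[R]_d) : 0 <= dotv v v.
Proof. by apply: sumr_ge0 => i _; rewrite -expr2 sqr_ge0. Qed.

Lemma dotvv_eq0 d (v : 'cV[R]_d) : (dotv v v == 0) = (v == 0).
Proof.
apply/idP/eqP => [|->]; last by rewrite dotv0l.
rewrite psumr_eq0 => [/allP h|i _]; last by rewrite -expr2 sqr_ge0.
apply/colP => i; rewrite mxE; apply/eqP.
by have := h i (mem_index_enum _); rewrite mulf_eq0 orbb.
Qed.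

Lemma l2normE d (v : 'cV[R]_d) : l2norm v = Num.sqrt (dotv v v).
Proof. by []. Qed.

Lemma l2norm_ge0 d (v : 'cV[R]_d) : 0 <= l2norm v.
Proof. exact: sqrtr_ge0. Qed.

Lemma sqr_l2norm d (v : 'cV[R]_d) : l2norm v ^+ 2 = dotv v v.
Proof. by rewrite l2normE sqr_sqrtr ?dotvv_ge0. Qed.

Lemma l2norm_eq0 d (v : 'cV[R]_d) : (l2norm v == 0) = (v == 0).
Proof. by rewrite -dotvv_eq0 -sqr_l2norm sqrf_eq0. Qed.

Lemma l2norm0 d : l2norm (0 : 'cV[R]_d) = 0.
Proof. by apply/eqP; rewrite l2norm_eq0. Qed.

Lemma l2norm_gt0 d (v : 'cV[R]_d) : (0 < l2norm v) = (v != 0).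
Proof. by rewrite lt_def l2norm_ge0 andbT l2norm_eq0. Qed.

Lemma l2normN d (v : 'cV[R]_d) : l2norm (- v) = l2norm v.
Proof. by rewrite !l2normE !dotvE opprK. Qed.

Lemma l2normB d (u v : 'cV[R]_d) : l2norm (u - v) = l2norm (v - u).
Proof. by rewrite -l2normN opprB. Qed.

Lemma l2normZ d a (v : 'cV[R]_d) : l2norm (a *: v) = `|a| * l2norm v.
Proof. by rewrite !l2normE !dotvE mulrA -expr2 sqrtrM ?sqr_ge0// sqrtr_sqr. Qed.

(** Expand the square of [|v| u - |u| v], which is nonnegative. *)
Lemma CauchySchwarz_dotv d (u v : 'cV[R]_d) : dotv u v <= l2norm u * l2norm v.
Proof.
have [->|u0] := eqVneq u 0; first by rewrite dotv0l l2norm0 mul0r.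
have [->|v0] := eqVneq v 0; first by rewrite dotv0r l2norm0 mulr0.
have nu : 0 < l2norm u by rewrite l2norm_gt0.
have nv : 0 < l2norm v by rewrite l2norm_gt0.
have := dotvv_ge0 (l2norm v *: u - l2norm u *: v).
rewrite !dotvE (dotvC v u) -!sqr_l2norm => h.
rewrite -(ler_pM2l (mulr_gt0 nu nv)); nra.
Qed.

Lemma l2norm_triangle d (u v : 'cV[R]_d) : l2norm (u + v) <= l2norm u + l2norm v.
Proof.
rewrite -(@ler_pXn2r _ 2) ?nnegrE ?addr_ge0 ?l2norm_ge0//.
rewrite sqr_l2norm !dotvE (dotvC v u) sqrrD !sqr_l2norm.
have := CauchySchwarz_dotv u v; lra.
Qed.

Lemma dotv_le d (u v : 'cV[R]_d) a b : l2norm u <= a -> l2norm v <= b ->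
  dotv u v <= a * b.
Proof.
move=> ua vb; rewrite (le_trans (CauchySchwarz_dotv _ _))//.
by apply: ler_pM; rewrite ?l2norm_ge0.
Qed.

Lemma l2normD_le d (u v : 'cV[R]_d) a b : l2norm u <= a -> l2norm v <= b ->
  l2norm (u + v) <= a + b.
Proof. by move=> ua vb; rewrite (le_trans (l2norm_triangle _ _))// lerD. Qed.

Lemma l2normB_le d (u v : 'cV[R]_d) a b : l2norm u <= a -> l2norm v <= b ->
  l2norm (u - v) <= a + b.
Proof. by move=> ua vb; rewrite l2normD_le// l2normN. Qed.

Lemma l2normZ_le d (u : 'cV[R]_d) a t : 0 < t -> l2norm u <= a ->
  l2norm (t *: u) <= t * a.
Proof. by move=> t0 ua; rewrite l2normZ gtr0_norm// ler_pM2l. Qed.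

Lemma l2norm_dist d (u v w : 'cV[R]_d) :
  l2norm (u - w) <= l2norm (u - v) + l2norm (v - w).
Proof. by have := l2norm_triangle (u - v) (v - w); rewrite addrA subrK. Qed.

Lemma coord_le_l2norm d (v : 'cV[R]_d) i : `|v i 0| <= l2norm v.
Proof.
rewrite -sqrtr_sqr ler_wsqrtr// (bigD1 i)//= lerDl.
by apply: sumr_ge0 => j _; rewrite sqr_ge0.
Qed.

Lemma coord_le_norm d (v : 'cV[R]_d) i : `|v i 0| <= `|v|.
Proof. by rewrite /Num.norm/= mx_normrE (le_bigmax _ (fun ij => `|v ij.1 ij.2|) (i, 0)). Qed.

(** Matrices carry the topology of the max norm; this bound and the converse one
make it agree with the Euclidean one. *)
Lemma l2norm_le_norm d (v : 'cV[R]_d) : l2norm v <= d%:R * `|v|.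
Proof.
rewrite -(@ler_pXn2r _ 2) ?nnegrE ?mulr_ge0 ?l2norm_ge0//.
rewrite sqr_l2norm.
have h : dotv v v <= \sum_(i < d) `|v| ^+ 2.
  apply: ler_sum => i _; rewrite -expr2 -real_normK ?num_real//.
  by rewrite ler_pXn2r ?nnegrE// coord_le_norm.
apply: (le_trans h); rewrite sumr_const card_ord -[leLHS]mulr_natl exprMn.
rewrite ler_wpM2r ?sqr_ge0// expr2 -natrM ler_nat.
by case: (d) => // k; rewrite leq_pmull.
Qed.

Lemma norm_le_l2norm d (v : 'cV[R]_d) : `|v| <= l2norm v.
Proof.
rewrite /Num.norm/= mx_normrE; apply/bigmax_leP; split; first exact: l2norm_ge0.
by move=> [i j] _ /=; rewrite (ord1 j) coord_le_l2norm.
Qed.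

Lemma normr_trmx d (v : 'rV[R]_d) : `|v^T| = `|v|.
Proof.
rewrite /Num.norm/= !mx_normrE; apply/eqP; rewrite eq_le.
apply/andP; split; apply/bigmax_leP; split=> [|[i j] _ /=];
  rewrite ?bigmax_ge_id//.
- by rewrite mxE (le_bigmax _ (fun ij => `|v ij.1 ij.2|) (j, i)).
- have := le_bigmax 0 (fun ij => `|v^T ij.1 ij.2|) (j, i).
  by rewrite /= mxE.
Qed.

(** Closedness phrased with Euclidean approximations, so that it can be checked
by inequalities and without filters. *)
Definition l2closed d (K : set 'cV[R]_d) :=
  forall v, (forall e, 0 < e -> exists2 u, K u & l2norm (u - v) < e) -> K v.

(** The only compactness argument of the development: projections, extremal
strategies, the Rayleigh maximiser and the constant in Hoffman's bound are all
obtained as minimisers of Lipschitz functions.  The extreme value theorem is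
applied to row vectors and transposed. *)
Lemma lipschitz_min d (f : 'cV[R]_d -> R) (K : set 'cV[R]_d) L :
  K !=set0 -> bounded_set K -> l2closed K ->
  (forall u v, K u -> K v -> f u - f v <= L * l2norm (u - v)) ->
  exists2 c, K c & forall v, K v -> f c <= f v.
Proof.
move=> [k0 Kk0] bK cK Lf.
have l2le e : 0 < e -> exists2 r, 0 < r & forall v : 'cV[R]_d, `|v| < r -> l2norm v < e.
  move=> e0; have d0 : 0 < d%:R + 1 :> R by rewrite ltr_wpDl.
  exists (e / (d%:R + 1)); first by rewrite divr_gt0.
  move=> v; rewrite ltr_pdivlMr// => ve; apply: (le_lt_trans (l2norm_le_norm v)).
  by apply: le_lt_trans ve; rewrite mulrC mulrDr mulr1 lerDl.
have [|||c] := @EVT_min_rV R d (fun r => f r^T) [set r : 'rV[R]_d | K r^T].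
- by exists k0^T; rewrite /= trmxK.
- apply: bounded_closed_compact.
    case: bK => M [Mr h]; exists M; split=> // x Mx r/= Kr.
    by rewrite -normr_trmx; apply: h.
  move=> r rK; apply: cK => e /l2le[s s0 hs].
  have [u [/= Ku ur]] := rK _ (nbhsx_ballx r s s0).
  exists u^T => //; apply: hs; rewrite -linearB/= normr_trmx -opprB normrN.
  by move: ur; rewrite -ball_normE.
- apply/subspace_continuousP => r Kr; apply/cvgrPdist_lt => e e0.
  have L0 : 0 < `|L| + 1 by rewrite ltr_wpDl.
  have [s s0 hs] := l2le _ (divr_gt0 e0 L0).
  rewrite near_withinE; apply: filterS (nbhsx_ballx r s s0) => u ru Ku.
  have {hs ru}ru : l2norm (r^T - u^T) < e / (`|L| + 1).
    by apply: hs; rewrite -linearB/= normr_trmx; move: ru; rewrite -ball_normE.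
  have h w w' : K w -> K w' -> f w - f w' <= (`|L| + 1) * l2norm (w - w').
    move=> Kw Kw'; apply: le_trans (Lf _ _ Kw Kw') _.
    by rewrite ler_wpM2r ?l2norm_ge0// (le_trans (ler_norm _)) ?lerDl.
  move: ru; rewrite ltr_pdivlMr// mulrC => ru.
  have h1 := h _ _ Kr Ku; have h2 := h _ _ Ku Kr.
  rewrite l2normB in h2.
  rewrite ltr_norml; apply/andP; split; last exact: le_lt_trans h1 ru.
  by rewrite ltrNl opprB; exact: le_lt_trans h2 ru.
- rewrite inE/= => Kc h; exists c^T => // v Kv.
  by have := h v^T; rewrite inE/= trmxK; apply.
Qed.

End Euclid.

(** * Projections, polyhedra and Hoffman's error bound *)

Section Polyhedra.
Context {R : realType}.
Implicit Types d m n : nat.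

(** First-order conditions are read off perturbation inequalities with this
lemma: dividing a second-order expansion by the step and letting the step tend
to 0. *)
Lemma le0_small (a b t0 : R) : 0 < t0 ->
  (forall t, 0 < t -> t <= t0 -> a <= t * b) -> a <= 0.
Proof.
move=> t00 h; rewrite leNgt; apply/negP => a0.
have b0 : 0 < b.
  by rewrite -(pmulr_rgt0 _ t00); apply: (lt_le_trans a0); exact: h.
have := h (Num.min t0 (a / (2 * b))).
rewrite lt_min t00 ge_min lexx/= divr_gt0 ?mulr_gt0// => /(_ isT isT).
apply/negP; rewrite -ltNge.
have : Num.min t0 (a / (2 * b)) * b <= a / 2.
  rewrite -ler_pdivlMr// ge_min; apply/orP; right.
  by rewrite invfM mulrA.
move=> /le_lt_trans; apply; lra.
Qed.

Lemma small_uniform (J : finType) (P : J -> R -> Prop) :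
  (forall j, exists2 t0, 0 < t0 & forall t, 0 < t -> t <= t0 -> P j t) ->
  exists2 t0, 0 < t0 & forall t, 0 < t -> t <= t0 -> forall j, P j t.
Proof.
move=> h; have /fin_all_exists[s hs] : forall j, exists t0,
    0 < t0 /\ forall t, 0 < t -> t <= t0 -> P j t.
  by move=> j; have [t0 ? ?] := h j; exists t0.
exists (\big[Num.min/1]_j s j).
  by apply: lt_bigmin => // j _; have [] := hs j.
move=> t t0 tj j; have [_] := hs j; apply=> //.
exact: (le_trans tj (bigmin_le _ _ _)).
Qed.

Definition is_convex d (S : set 'cV[R]_d) :=
  forall u v t, S u -> S v -> 0 < t -> t <= 1 -> S (u + t *: (v - u)).

(** Moving from the projection [p] a little in a feasible direction [e] does not
bring it closer to [v]; the first-order term of [|v - p - t e|^2] gives the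
sign. *)
Lemma proj_dir d (S : set 'cV[R]_d) v p e t0 : is_proj S v p -> 0 < t0 ->
  (forall t, 0 < t -> t <= t0 -> S (p + t *: e)) -> dotv (v - p) e <= 0.
Proof.
move=> [Sp hp] t00 h.
suff : 2 * dotv (v - p) e <= 0 by lra.
apply: (le0_small (b := dotv e e) t00) => t tp tt.
have := hp _ (h t tp tt).
rewrite opprD addrA -(@ler_pXn2r _ 2) ?nnegrE ?l2norm_ge0// !sqr_l2norm.
move: (v - p) => w; rewrite !dotvE (dotvC e w) => h1.
rewrite -(ler_pM2l tp); lra.
Qed.

Lemma proj_obtuse d (S : set 'cV[R]_d) v p q : is_convex S ->
  is_proj S v p -> S q -> dotv (v - p) (q - p) <= 0.
Proof.
move=> cS Sp Sq; apply: (proj_dir (t0 := 1) Sp) => // t t0 t1.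
by apply: cS => //; case: Sp.
Qed.

Definition compact_convex d (S : set 'cV[R]_d) :=
  [/\ S !=set0, bounded_set S, l2closed S & is_convex S].

Lemma projP d (S : set 'cV[R]_d) v : compact_convex S -> is_proj S v (Defs.proj S v).
Proof.
move=> [S0 bS cS _]; rewrite /Defs.proj; apply: xgetPex.
have [|p Sp hp] := @lipschitz_min _ _ (fun p => l2norm (v - p)) S 1 S0 bS cS.
  move=> u w _ _; rewrite mul1r (l2normB u w).
  have := l2norm_dist v w u; lra.
by exists p; split.
Qed.

Lemma proj_in d (S : set 'cV[R]_d) v : compact_convex S -> S (Defs.proj S v).
Proof. by move=> /(projP v)[]. Qed.

Lemma l2bounded d (S : set 'cV[R]_d) : bounded_set S ->
  exists2 M, 0 < M & forall v, S v -> l2norm v <= M.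
Proof.
move=> [M [Mr h]].
have h1 v : S v -> `|v| <= `|M| + 1.
  by move=> Sv; apply: h => //; rewrite (le_lt_trans (ler_norm _))// ltrDl.
exists (d%:R * (`|M| + 1) + 1).
  by rewrite ltr_wpDl// mulr_ge0// addr_ge0.
move=> v Sv; apply: (le_trans (l2norm_le_norm v)).
by rewrite (@le_trans _ _ (d%:R * (`|M| + 1)))// ?lerDl// ler_wpM2l// h1.
Qed.

Definition halfspaces d (J : finType) (b : J -> 'cV[R]_d) (c : J -> R) :
  set 'cV[R]_d := [set v | forall j, dotv (b j) v <= c j].

Lemma l2closed_sphere d : l2closed [set v : 'cV[R]_d | l2norm v = 1].
Proof.
move=> v hv; apply/eqP; rewrite -subr_eq0 -normr_le0.
apply: (le0_small (t0 := 1) (b := 1)) => // t t0 _.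
have [u u1 uv] := hv t t0; rewrite mulr1 -[X in _ - X]u1.
have h1 := l2norm_dist v u 0; have h2 := l2norm_dist u v 0.
rewrite !subr0 (l2normB v u) in h1 h2.
rewrite ler_norml; apply/andP; split; lra.
Qed.

Lemma convex_halfspaces d (J : finType) (b : J -> 'cV[R]_d) c :
  is_convex (halfspaces b c).
Proof.
move=> u v t hu hv t0 t1 j; rewrite !dotvE.
have := hu j; have := hv j; nra.
Qed.

Lemma l2closed_halfspaces d (J : finType) (b : J -> 'cV[R]_d) c :
  l2closed (halfspaces b c).
Proof.
move=> v h j; rewrite -subr_le0.
apply: (le0_small (t0 := 1) (b := l2norm (b j))) => // t t0 _.
have [u hu uv] := h t t0.
have := CauchySchwarz_dotv (b j) (v - u); rewrite dotvE l2normB => h1.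
have := hu j; have := l2norm_ge0 (b j); nra.
Qed.

Definition active d (J : finType) (b : J -> 'cV[R]_d) (c : J -> R) v : {set J} :=
  [set j | dotv (b j) v == c j]%SET.

(** Inactive constraints have some slack, and there are finitely many of them, so
only the active ones restrict the directions in which one can move. *)
Lemma feasible_dir d (J : finType) (b : J -> 'cV[R]_d) c v e :
  halfspaces b c v ->
  (forall j, j \in active b c v -> dotv (b j) e <= 0) ->
  exists2 t0, 0 < t0 & forall t, 0 < t -> t <= t0 -> halfspaces b c (v + t *: e).
Proof.
move=> hv he; apply: small_uniform => j.
have [ja|] := boolP (j \in active b c v).
  exists 1 => // t t0 _; rewrite !dotvE.
  have := he j ja; have := hv j; nra.
rewrite inE => nj.
have slack : 0 < c j - dotv (b j) v.
  by rewrite subr_gt0 lt_neqAle nj; exact: hv.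
have n0 : 0 < `|dotv (b j) e| + 1 by rewrite ltr_wpDl.
exists ((c j - dotv (b j) v) / (`|dotv (b j) e| + 1)); first exact: divr_gt0.
move=> t t0; rewrite ler_pdivlMr// !dotvE => h.
have := ler_norm (dotv (b j) e); nra.
Qed.

Lemma compact_convexI d (S : set 'cV[R]_d) (J : finType) (b : J -> 'cV[R]_d) c :
  compact_convex S -> S `&` halfspaces b c !=set0 ->
  compact_convex (S `&` halfspaces b c).
Proof.
move=> [_ bS cloS coS] S0; split=> //.
- by case: bS => N [Nr hN]; exists N; split=> // z Nz u [Xu _]; exact: hN.
- move=> z hz; split.
    by apply: cloS => e /hz[u [Xu _] ?]; exists u.
  by apply: l2closed_halfspaces => e /hz[u [_ Xu] ?]; exists u.
- move=> u z t [Xu Hu] [Xz Hz] t0 t1; split; first exact: coS.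
  exact: convex_halfspaces.
Qed.

(** Unit vectors of the normal cone determined by the set [I] of active
constraints, described as a polar cone so that no multipliers are needed. *)
Definition normal_dirs d (J : finType) (b : J -> 'cV[R]_d) (I : {set J}) :=
  [set u : 'cV[R]_d | l2norm u = 1 /\
     forall e, (forall i, i \in I -> dotv (b i) e <= 0) -> dotv u e <= 0].

(** If no constraint of [I] increased along [u], then [u] itself would be a
feasible direction and polarity would give [dotv u u <= 0].  So the total increase is
positive on a compact set, hence bounded away from 0. *)
Lemma normal_dirs_gap d (J : finType) (b : J -> 'cV[R]_d) (I : {set J}) :
  exists alpha, 0 < alpha /\ forall u, normal_dirs b I u ->
    alpha <= \sum_(i in I) Num.max 0 (dotv (b i) u).
Proof.
have [N0|] := pselect (normal_dirs b I !=set0); last first.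
  by move=> N0; exists 1; split=> // u Nu; exfalso; apply: N0; exists u.
have [|||u [u1 hu] umin] := @lipschitz_min _ _
  (fun u => \sum_(i in I) Num.max 0 (dotv (b i) u)) _ (\sum_(i in I) l2norm (b i)) N0.
- exists 1; split=> // x x1 u/= [u1 _].
  by rewrite (le_trans (norm_le_l2norm u))// u1 ltW.
- move=> v hv; split.
    by apply: l2closed_sphere => e /hv[u [u1 _] uv]; exists u.
  move=> e he; apply: (le0_small (t0 := 1) (b := l2norm e)) => // t t0 _.
  have [u [_ hu] uv] := hv t t0.
  have := CauchySchwarz_dotv (v - u) e; rewrite dotvE l2normB => h1.
  have := hu e he; have := l2norm_ge0 e; nra.
- move=> u v _ _; rewrite -sumrB mulr_suml; apply: ler_sum => i _.
  have := CauchySchwarz_dotv (b i) (u - v); rewrite dotvE => h.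
  have h0 : 0 <= l2norm (b i) * l2norm (u - v) by rewrite mulr_ge0 ?l2norm_ge0.
  by rewrite lerBlDr ge_max; apply/andP; split;
    rewrite -lerBlDl ?subr0; case: (leP 0 (dotv (b i) v)) => ?; lra.
exists (\sum_(i in I) Num.max 0 (dotv (b i) u)); split=> //.
rewrite lt_def sumr_ge0 ?andbT; last by move=> i _; rewrite le_max lexx.
apply/negP; rewrite psumr_eq0 => [/allP h|i _]; last by rewrite le_max lexx.
have : dotv u u <= 0.
  apply: hu => i iI; have := h i (mem_index_enum _); rewrite iI/= => /eqP <-.
  by rewrite le_max lexx orbT.
by rewrite -sqr_l2norm u1 expr1n ler10.
Qed.

(** Hoffman's bound.  The displacement [v - s] from the projection [s] lies in the
normal cone of the constraints active at [s]; since these are tight at [s], their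
violation at [v] is their increase along [v - s], at least [alpha I] times the
length by [normal_dirs_gap].  There are finitely many active sets [I], so
the constants combine into one. *)
Lemma hoffman d (J : finType) (b : J -> 'cV[R]_d) c :
  exists2 kappa, 0 < kappa & forall v s e, is_proj (halfspaces b c) v s -> 0 <= e ->
    (forall j, dotv (b j) v - c j <= e) -> l2norm (v - s) <= kappa * e.
Proof.
have /fin_all_exists[alpha ha] := normal_dirs_gap b.
have k0 I : 0 <= #|J|%:R / alpha I :> R.
  by rewrite divr_ge0//; have [/ltW] := ha I.
(* a sum over all active sets dominates each of them; the 1 makes it positive *)
exists (\sum_I #|J|%:R / alpha I + 1); first by rewrite ltr_wpDl// sumr_ge0.
move=> v s e vs e0 he.
have [->|vs0] := eqVneq v s.
  rewrite subrr l2norm0 mulr_ge0// addr_ge0// sumr_ge0//.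
have n0 : 0 < l2norm (v - s) by rewrite l2norm_gt0 subr_eq0.
have hs : halfspaces b c s by case: vs.
pose I := active b c s.
pose u := (l2norm (v - s))^-1 *: (v - s).
have Nu : normal_dirs b I u.
  split; first by rewrite l2normZ ger0_norm ?invr_ge0 ?l2norm_ge0// mulVf// gt_eqF.
  move=> f hf; rewrite dotvZl pmulr_rle0 ?invr_gt0//.
  have [t0 t00 ht] := feasible_dir hs hf.
  exact: proj_dir vs t00 ht.
have [a0 /(_ _ Nu) hu] := ha I.
have hub : \sum_(i in I) Num.max 0 (dotv (b i) u) <= #|J|%:R * (e / l2norm (v - s)).
  have le1 : \sum_(i in I) Num.max 0 (dotv (b i) u) <= \sum_(i in I) e / l2norm (v - s).
    apply: ler_sum => i; rewrite inE => /eqP ci.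
    rewrite ge_max divr_ge0 ?l2norm_ge0//= dotvZr mulrC ler_wpM2r ?invr_ge0 ?l2norm_ge0//.
    by rewrite dotvE ci.
  apply: (le_trans le1); rewrite sumr_const -[leLHS]mulr_natl ler_wpM2r//.
    by rewrite divr_ge0 ?l2norm_ge0.
  by rewrite ler_nat max_card.
have h1 : alpha I * l2norm (v - s) <= #|J|%:R * e.
  by rewrite -ler_pdivlMr// -mulrA (le_trans hu).
have h2 : l2norm (v - s) <= #|J|%:R / alpha I * e.
  by rewrite mulrAC ler_pdivlMr// mulrC.
apply: (le_trans h2); rewrite ler_wpM2r//.
rewrite (bigD1 I)//= -addrA lerDl addr_ge0// sumr_ge0//.
Qed.

(** One representative per face replaces the vertices: linear functions are
maximised at one of finitely many points.  If [u] is a maximiser and [w0] is any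
point with the same active set, then [u + t (u - w0)] is feasible for small [t],
so the value at [u] cannot exceed the value at [w0].  In other words a linear
function that attains its maximum in the relative interior of a face is constant
on that face. *)
Lemma halfspaces_faces d (J : finType) (b : J -> 'cV[R]_d) c :
  halfspaces b c !=set0 -> bounded_set (halfspaces b c) ->
  exists w : {set J} -> 'cV[R]_d, (forall I, halfspaces b c (w I)) /\
    forall g v, halfspaces b c v -> exists I, dotv g v <= dotv g (w I).
Proof.
move=> Q0 bQ; have [q0 Qq0] := Q0.
pose face I := [set v | halfspaces b c v /\ active b c v = I].
pose w I := xget q0 (face I).
have Qw I : halfspaces b c (w I).
  by rewrite /w; case: xgetP => // v -> [].
exists w; split=> // g v Qv.
have [|u Qu umax] := @lipschitz_min _ _ (fun v => dotv (- g) v) _ (l2norm (- g))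
  Q0 bQ (@l2closed_halfspaces _ _ _ _).
  by move=> x y _ _; rewrite -dotvBr CauchySchwarz_dotv.
exists (active b c u).
have fu : face (active b c u) u by [].
have [Qwu au] : face (active b c u) (w (active b c u)).
  exact: (xgetPex _ (ex_intro _ u fu)).
set w0 := w _ in Qwu au *.
have : forall j, j \in active b c u -> dotv (b j) (u - w0) <= 0.
  move=> j ju; have := ju; rewrite -{1}au; move: ju; rewrite !inE => /eqP e1 /eqP e2.
  by rewrite dotvE e1 e2 subrr.
move=> /(feasible_dir Qu)[t0 t00 /(_ t0 t00 (lexx _)) Qt].
have := umax _ Qv; have := umax _ Qt; rewrite !dotvE => h1 h2.
have : dotv g u <= dotv g w0 by nra.
lra.
Qed.

End Polyhedra.

(** * Saddle points of the perturbed game and its exactness *)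

Section Saddle.
Context {R : realType}.
Implicit Types d m n : nat.

Lemma polyhedron_halfspaces d (S : set 'cV[R]_d) : polyhedron S ->
  exists k (b : 'I_k -> 'cV[R]_d) c, S = halfspaces b c.
Proof.
move=> [k [B [b ->]]]; exists k, (fun i => (row i B)^T), (fun i => b i 0).
have E v i : dotv (row i B)^T v = (B *m v) i 0.
  by rewrite dotv_mx trmxK -row_mul mxE.
by apply/seteqP; split=> v /= h i; [rewrite E|rewrite -E]; exact: h.
Qed.

Lemma polytope_compact_convex d (S : set 'cV[R]_d) :
  polytope S -> S !=set0 -> compact_convex S.
Proof.
move=> [/polyhedron_halfspaces[k [b [c ->]]] bS] S0; split=> //.
  exact: (@l2closed_halfspaces _ _ _ b c).
exact: (@convex_halfspaces _ _ _ b c).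
Qed.

Lemma polytope_faces d (S : set 'cV[R]_d) : polytope S -> S !=set0 ->
  exists (T : finType) (w : T -> 'cV[R]_d), (forall i, S (w i)) /\
    forall g v, S v -> exists i, dotv g v <= dotv g (w i).
Proof.
move=> [/polyhedron_halfspaces[k [b [c ->]]] bS] S0.
have [w hw] := halfspaces_faces S0 bS.
by exists {set 'I_k}, w.
Qed.

(** Hoffman's bound relative to a polyhedron [S]: for points of [S] only the
additional constraints can be violated. *)
Lemma polyhedron_hoffman d (S : set 'cV[R]_d) (J : finType) (b : J -> 'cV[R]_d) c :
  polyhedron S -> exists2 kappa, 0 < kappa & forall v s e, S v ->
    is_proj (S `&` halfspaces b c) v s -> 0 <= e ->
    (forall j, dotv (b j) v - c j <= e) -> l2norm (v - s) <= kappa * e.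
Proof.
move=> /polyhedron_halfspaces[k [b' [c' ->]]].
pose bb (j : 'I_k + J) := match j with inl i => b' i | inr j => b j end.
pose cc (j : 'I_k + J) := match j with inl i => c' i | inr j => c j end.
have E : halfspaces b' c' `&` halfspaces b c = halfspaces bb cc.
  apply/seteqP; split=> [v [h1 h2] [i|j]|v h]; [exact: h1|exact: h2|].
  by split=> j; [exact: (h (inl j))|exact: (h (inr j))].
have [kappa k0 hk] := hoffman bb cc.
exists kappa => // v s e Sv; rewrite E => vs e0 he; apply: hk => // -[i|j] //=.
by rewrite (le_trans _ e0)// subr_le0; exact: Sv.
Qed.

Lemma argmax_linear d (S : set 'cV[R]_d) g : compact_convex S ->
  exists u, S u /\ forall v, S v -> dotv g v <= dotv g u.
Proof.
move=> [S0 bS cS _].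
have [|u Su umax] := @lipschitz_min _ _ (fun v => dotv (- g) v) _ (l2norm (- g)) S0 bS cS.
  by move=> x y _ _; rewrite -dotvBr CauchySchwarz_dotv.
by exists u; split=> // v Sv; have := umax _ Sv; rewrite !dotvNl lerN2.
Qed.

(** The Frobenius norm: an operator bound that is easily read off the entries. *)
Definition frob m n (A : 'M[R]_(m, n)) := Num.sqrt (\sum_i \sum_j A i j ^+ 2).

Lemma frob_ge0 m n (A : 'M[R]_(m, n)) : 0 <= frob A.
Proof. exact: sqrtr_ge0. Qed.

Lemma l2norm_mulmx m n (A : 'M[R]_(m, n)) v :
  l2norm (A *m v) <= frob A * l2norm v.
Proof.
have s0 : 0 <= \sum_i \sum_j A i j ^+ 2.
  by apply: sumr_ge0 => i _; apply: sumr_ge0 => j _; rewrite sqr_ge0.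
rewrite -(@ler_pXn2r _ 2) ?nnegrE ?mulr_ge0 ?l2norm_ge0 ?frob_ge0//.
have E : frob A ^+ 2 = \sum_i \sum_j A i j ^+ 2 by rewrite sqr_sqrtr.
rewrite exprMn E mulr_suml sqr_l2norm; apply: ler_sum => i _.
have -> : (A *m v) i 0 = dotv (row i A)^T v.
  by rewrite dotv_mx trmxK -row_mul [RHS]mxE.
have -> : \sum_j A i j ^+ 2 = l2norm (row i A)^T ^+ 2.
  by rewrite sqr_l2norm; apply: eq_bigr => j _; rewrite !mxE expr2.
rewrite -expr2 -exprMn -[leLHS]real_normK ?num_real//.
rewrite ler_pXn2r ?nnegrE ?mulr_ge0 ?l2norm_ge0//.
rewrite ler_norml; apply/andP; split; last exact: CauchySchwarz_dotv.
by rewrite lerNl -dotvNl -(l2normN (row i A)^T) CauchySchwarz_dotv.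
Qed.

Lemma l2norm_mulmx_le p q (B : 'M[R]_(p, q)) v a : l2norm v <= a ->
  l2norm (B *m v) <= frob B * a.
Proof. by move=> va; rewrite (le_trans (l2norm_mulmx _ _))// ler_wpM2l ?frob_ge0. Qed.

Lemma frob_le m n (A : 'M[R]_(m, n)) : (forall i j, `|A i j| <= 1) ->
  frob A ^+ 2 <= (m * n)%:R.
Proof.
move=> h; rewrite sqr_sqrtr; last first.
  by apply: sumr_ge0 => i _; apply: sumr_ge0 => j _; rewrite sqr_ge0.
have -> : (m * n)%:R = \sum_(i < m) \sum_(j < n) 1 :> R.
  by rewrite !sumr_const !card_ord natrM -[RHS]mulr_natl.
apply: ler_sum => i _; apply: ler_sum => j _.
by rewrite -real_normK ?num_real// expr_le1.
Qed.

(** Saddle points of [x^T A y + mu/2 |x|^2] on [X x Y], given by the variational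
inequality: this form is the one that the projections and the stopping rules see. *)
Definition saddle m n (A : 'M[R]_(m, n)) (X : set 'cV[R]_m) (Y : set 'cV[R]_n)
    (mu : R) x y :=
  [/\ X x, Y y, forall x', X x' -> 0 <= dotv (A *m y + mu *: x) (x' - x) &
      forall y', Y y' -> 0 <= dotv (A^T *m x) (y - y')].

(** For fixed [y] the minimiser over [X] is the projection of [- A y / mu], and it
depends continuously on [y].  Take [y] maximising the resulting minimum.
If [y'] improved on [y] against the best response [xb y], then moving a little
from [y] towards [y'] would raise the minimum, because the best responses [xt]
along the segment stay close to [xb y]. *)
Lemma saddle_exists m n (A : 'M[R]_(m, n)) X Y mu : compact_convex X ->
  compact_convex Y -> 0 < mu -> exists x y, saddle A X Y mu x y.
Proof.
move=> cX cY mu0.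
have [xb xbX xbP] : exists2 xb : 'cV[R]_n -> 'cV[R]_m, forall y, X (xb y) &
    forall y x', X x' -> 0 <= dotv (A *m y + mu *: xb y) (x' - xb y).
  exists (fun y => Defs.proj X (- mu^-1 *: (A *m y))) => [y|y x' Xx'].
    by have [] := projP (- mu^-1 *: (A *m y)) cX.
  have [_ _ _ coX] := cX.
  have := proj_obtuse coX (projP (- mu^-1 *: (A *m y)) cX) Xx'.
  move: (Defs.proj _ _) => x.
  rewrite -(pmulr_rle0 _ mu0) -dotvZl scalerBr scalerA mulrN mulfV ?gt_eqF//.
  by rewrite scaleN1r -opprD dotvNl oppr_le0.
pose phi x y := dotv x (A *m y) + mu / 2 * dotv x x.
have phi_min y x' : X x' ->
    phi (xb y) y + mu / 2 * l2norm (x' - xb y) ^+ 2 <= phi x' y.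
  move=> /(xbP y); rewrite /phi sqr_l2norm; move: (xb y) => x.
  rewrite !dotvE (dotvC x x') (dotvC (A *m y)) (dotvC (A *m y)); lra.
have [MX MX0 hMX] : exists2 M, 0 < M & forall v, X v -> l2norm v <= M.
  by case: cX => _ + _ _; exact: l2bounded.
have [Y0 bY cloY coY] := cY.
have [|y Yy ymax] := @lipschitz_min _ _ (fun y => - phi (xb y) y) Y (frob A^T * MX)
  Y0 bY cloY.
  move=> u v _ _; have := phi_min v (xb u) (xbX u).
  have h : 0 <= mu / 2 * l2norm (xb u - xb v) ^+ 2.
    by rewrite mulr_ge0 ?sqr_ge0// divr_ge0// ltW.
  have : dotv (- (A^T *m xb u)) (u - v) <= frob A^T * MX * l2norm (u - v).
    apply: (le_trans (CauchySchwarz_dotv _ _)); rewrite ler_wpM2r ?l2norm_ge0//.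
    rewrite l2normN (le_trans (l2norm_mulmx _ _))// ler_wpM2l ?frob_ge0//.
    exact: hMX.
  rewrite dotvNl -dotv_mulmx mulmxBr dotvBr /phi; lra.
exists (xb y), y; split=> // [x'|y' Yy']; first exact: xbP.
(* the gain [s] of [y'] against [xb y] is O(t); the gain [st] against [xt] is
   nonpositive, and strong convexity bounds [|xt - xb y|^2] by [t (s - st) / mu] *)
pose e := y' - y.
suff : dotv (xb y) (A *m e) <= 0.
  by rewrite dotv_mulmx !dotvE; lra.
have Ye t : 0 < t -> t <= 1 -> Y (y + t *: e) by move=> *; exact: coY.
clearbody e; apply: (le0_small (t0 := 1) (b := l2norm (A *m e) ^+ 2 / mu)) => // t t0 t1.
have := ymax _ (Ye t t0 t1); set xt := xb (y + t *: e).
have := phi_min y xt (xbX _); have := phi_min (y + t *: e) _ (xbX y).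
rewrite -/xt (l2normB (xb y)).
have := CauchySchwarz_dotv (xb y - xt) (A *m e); rewrite -(l2normN (_ - xt)) opprB.
rewrite /phi mulmxDr -scalemxAr !dotvE.
move: (l2norm_ge0 (xt - xb y)) (l2norm_ge0 (A *m e)).
set dl := l2norm (xt - xb y); set ae := l2norm _.
set s := dotv (xb y) (A *m e); set st := dotv xt (A *m e).
move=> dl0 ae0 h1 h2 h3 h4.
have st0 : st <= 0.
  rewrite -(pmulr_rle0 _ t0).
  have : 0 <= mu / 2 * dl ^+ 2 by rewrite mulr_ge0 ?sqr_ge0// divr_ge0// ltW.
  lra.
have hr : mu * dl ^+ 2 <= t * (s - st) by lra.
rewrite mulrA ler_pdivlMr//.
have [s0|s0] := leP s 0.
  by apply: (@le_trans _ _ 0); [rewrite pmulr_lle0|rewrite mulr_ge0 ?sqr_ge0// ltW].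
have r0 : 0 < s - st by lra.
have : (s - st) ^+ 2 * mu <= t * (s - st) * ae ^+ 2.
  apply: (@le_trans _ _ ((dl * ae) ^+ 2 * mu)).
    by rewrite ler_pM2r// ler_pXn2r ?nnegrE ?mulr_ge0//; exact: ltW.
  by have := ler_wpM2r (sqr_ge0 ae) hr; lra.
have : (s - st) * (s * mu) <= (s - st) * ((s - st) * mu).
  by rewrite ler_pM2l// ler_pM2r//; lra.
move=> h5 h6; rewrite -(ler_pM2l r0); move: h5 h6; lra.
Qed.

Definition minmax_value m n (A : 'M[R]_(m, n)) (X : set 'cV[R]_m) (Y : set 'cV[R]_n) v :=
  (exists2 x, X x & forall y, Y y -> dotv x (A *m y) <= v) /\
  (forall x, X x -> exists2 y, Y y & v <= dotv x (A *m y)).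

Lemma minmax_value_exists m n (A : 'M[R]_(m, n)) X Y :
  compact_convex X -> compact_convex Y -> exists v, minmax_value A X Y v.
Proof.
move=> cX cY.
have /choice[best hbest] : forall x : 'cV[R]_m, exists y, Y y /\
    forall y', Y y' -> dotv (A^T *m x) y' <= dotv (A^T *m x) y.
  by move=> x; exact: argmax_linear.
have [MY MY0 hMY] : exists2 M, 0 < M & forall v, Y v -> l2norm v <= M.
  by case: cY => _ + _ _; exact: l2bounded.
have [X0 bX cloX _] := cX.
have [|x Xx xmin] := @lipschitz_min _ _ (fun x => dotv x (A *m best x)) X
  (frob A * MY) X0 bX cloX.
  move=> u v _ _.
  have [Yu _] := hbest u; have [_ /(_ _ Yu)] := hbest v.
  rewrite -!dotv_mulmx => h.
  have : dotv (A *m best u) (u - v) <= frob A * MY * l2norm (u - v).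
    apply: (le_trans (CauchySchwarz_dotv _ _)); rewrite ler_wpM2r ?l2norm_ge0//.
    rewrite (le_trans (l2norm_mulmx _ _))// ler_wpM2l ?frob_ge0//.
    exact: hMY.
  rewrite dotvC dotvBl; lra.
exists (dotv x (A *m best x)); split.
  exists x => // y Yy; have [_ /(_ _ Yy)] := hbest x.
  by rewrite -!dotv_mulmx.
move=> x' Xx'; exists (best x'); first by have [] := hbest x'.
exact: xmin.
Qed.

(** A small quadratic term does not move the minimiser of [max_y x^T A y] off the
set [P] of exact minimisers.  By [polytope_faces] that maximum is taken over finitely
many points of [Y], so [P] is a polyhedron and Hoffman's bound makes the distance
to [P] at most [kappa] times the excess [e] over the value.  Going from [x] to
its projection on [P] would save [e], whereas the quadratic term can only cost [mu M]
times that distance; for [mu M kappa <= 1/2] this forces [e = 0]. *)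
Lemma exact_penalty m n (A : 'M[R]_(m, n)) X Y v :
  polytope X -> X !=set0 -> polytope Y -> Y !=set0 -> minmax_value A X Y v ->
  exists2 mu0, 0 < mu0 & forall mu x y, 0 < mu -> mu <= mu0 ->
    saddle A X Y mu x y -> forall y', Y y' -> dotv x (A *m y') <= v.
Proof.
move=> pX X0 pY Y0 [[x0 Xx0 hx0] hv].
have [T [w [Yw hw]]] := polytope_faces pY Y0.
have [phX bX] := pX; pose b (i : T) := A *m w i; pose c (i : T) := v.
have [kappa k0 hk] := polyhedron_hoffman b c phX.
have [M M0 hM] := l2bounded bX.
have cP : compact_convex (X `&` halfspaces b c).
  apply: compact_convexI (polytope_compact_convex pX X0) _.
  by exists x0; split=> // i; rewrite dotvC; exact: hx0.
exists (2 * M * kappa)^-1; first by rewrite invr_gt0 !mulr_gt0.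
move=> mu x y mu0 hmu [Xx Yy sx sy].
have best y' : Y y' -> dotv x (A *m y') <= dotv x (A *m y).
  by move=> /sy; rewrite !dotv_mulmx dotvBr subr_ge0.
set e := dotv x (A *m y) - v.
have e0 : 0 <= e.
  by have [y' Yy' vy'] := hv x Xx; rewrite subr_ge0 (le_trans vy')// best.
have [[Xp Hp] _] := projP x cP; have := projP x cP.
set p := Defs.proj _ _ in Xp Hp * => hp.
have xp : l2norm (x - p) <= kappa * e.
  by apply: hk hp e0 _ => // i; rewrite lerB// dotvC best.
have vp : dotv p (A *m y) <= v.
  rewrite dotv_mulmx; have [i hi] := hw (A^T *m p) y Yy.
  by rewrite (le_trans hi)// -dotv_mulmx dotvC; exact: Hp.
have h1 : e <= mu * (M * (kappa * e)).
  have := sx p Xp; rewrite dotvDl dotvZl => h.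
  have : dotv x (p - x) <= M * (kappa * e).
    rewrite (le_trans (CauchySchwarz_dotv _ _))// l2normB.
    by apply: ler_pM; rewrite ?l2norm_ge0// hM.
  rewrite -(ler_pM2l mu0) /e; rewrite dotvBr !(dotvC (A *m y)) in h; lra.
have h2 : mu * (2 * M * kappa) <= 1.
  by rewrite -ler_pdivlMr ?div1r// !mulr_gt0.
have : e <= 0.
  have : mu * (2 * M * kappa) * e <= 1 * e by rewrite ler_wpM2r.
  lra.
by rewrite subr_le0 => ev y' Yy'; rewrite (le_trans (best _ Yy')).
Qed.

(** Strong duality; [v'] is the value of the game seen by the other player, so it
is the opposite of his maximin value.  A saddle point of the game perturbed by
[t] separates the two values by at most a multiple of [t]. *)
Lemma minimax m n (A : 'M[R]_(m, n)) X Y v v' :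
  compact_convex X -> compact_convex Y ->
  minmax_value A X Y v -> minmax_value (- A^T) Y X v' -> v + v' <= 0.
Proof.
move=> cX cY [_ hv] [_ hv'].
have [M M0 hM] : exists2 M, 0 < M & forall v, X v -> l2norm v <= M.
  by case: cX => _ + _ _; exact: l2bounded.
apply: (le0_small (t0 := 1) (b := M * (M + M))) => // t t0 _.
have [x [y [Xx Yy sx sy]]] := saddle_exists A cX cY t0.
have [y' Yy' h1] := hv x Xx; have [x' Xx' h2] := hv' y Yy.
have := sy y' Yy'; have := sx x' Xx'.
rewrite mulNmx dotvNr (dotv_mulmx _ y) trmxK in h2.
rewrite dotvDl dotvZl !dotvBr -!dotv_mulmx !(dotvC (A *m y)) -dotvBr => h3 h4.
rewrite (dotvC (A *m y)) in h2.
have : dotv x (x' - x) <= M * (M + M).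
  rewrite (le_trans (CauchySchwarz_dotv _ _))//; apply: ler_pM; rewrite ?l2norm_ge0 ?hM//.
  by rewrite (le_trans (l2norm_triangle _ _))// l2normN lerD// hM.
rewrite -(ler_pM2l t0); lra.
Qed.

End Saddle.

(** * Stopping gaps and loops *)

Section Gap.
Context {R : realType}.
Implicit Types m n : nat.

Lemma vi_gap_le m n (X : set 'cV[R]_m) (Y : set 'cV[R]_n) gx gy x y e :
  X !=set0 -> Y !=set0 ->
  (forall x' y', X x' -> Y y' -> dotv gx (x - x') + dotv gy (y - y') <= e) ->
  vi_gap X Y gx gy x y <= e.
Proof.
move=> [x0 Xx0] [y0 Yy0] h; rewrite /vi_gap -lerBrDl.
apply: ge_sup => [|_ [y' Yy' <-]]; first by exists (dotv gy (y - y0)), y0.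
rewrite lerBrDl -lerBrDr.
apply: ge_sup => [|_ [x' Xx' <-]]; first by exists (dotv gx (x - x0)), x0.
by rewrite lerBrDr h.
Qed.

Lemma vi_gap_ge m n (X : set 'cV[R]_m) (Y : set 'cV[R]_n) gx gy x y x' y' :
  bounded_set X -> bounded_set Y -> X x' -> Y y' ->
  dotv gx (x - x') + dotv gy (y - y') <= vi_gap X Y gx gy x y.
Proof.
have ub d (S : set 'cV[R]_d) g u v : bounded_set S -> S v ->
    dotv g (u - v) <= sup [set dotv g (u - v') | v' in S].
  move=> /l2bounded[M M0 hM] Sv; apply: ub_le_sup; last by exists v.
  exists (l2norm g * (l2norm u + M)) => _ [w Sw <-].
  rewrite (le_trans (CauchySchwarz_dotv _ _))// ler_wpM2l ?l2norm_ge0//.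
  by rewrite (le_trans (l2norm_triangle _ _))// l2normN lerD2l hM.
by move=> bX bY Xx' Yy'; apply: lerD; apply: ub.
Qed.

Lemma nashconv_le m n (A : 'M[R]_(m, n)) X Y x y :
  X !=set0 -> Y !=set0 -> bounded_set X -> bounded_set Y ->
  nashconv A X Y x y <= vi_gap X Y (A *m y) (- (A^T *m x)) x y.
Proof.
move=> [x0 Xx0] [y0 Yy0] bX bY; rewrite /nashconv lerBlDr.
apply: ge_sup => [|_ [y' Yy' <-]]; first by exists (dotv x (A *m y0)), y0.
rewrite -lerBlDl; apply: lb_le_inf => [|_ [x' Xx' <-]].
  by exists (dotv x0 (A *m y)), x0.
have := vi_gap_ge (A *m y) (- (A^T *m x)) x y bX bY Xx' Yy'.
rewrite !dotvE -!dotv_mulmx !(dotvC (A *m y)); lra.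
Qed.

Lemma vi_gapC m n (X : set 'cV[R]_m) (Y : set 'cV[R]_n) gx gy x y :
  vi_gap X Y gx gy x y = vi_gap Y X gy gx y x.
Proof. by rewrite /vi_gap addrC. Qed.

End Gap.

Section Loop.
Variables (T : Type) (step : T -> T) (stop : T -> Prop).

Lemma repeat_until_reached (inv : T -> Prop) s t : inv s ->
  (forall s, inv s -> inv (step s)) -> stop (iter t.+1 step s) ->
  exists N s', [/\ repeat_until step stop s N s', inv s' & (N <= t.+1)%N].
Proof.
move=> + hinv; elim: t s => [|t IH] s hs.
  by move=> st; exists 1%N, (step s); split; [apply: repeat_stop|apply: hinv|].
have [st _|nst] := pselect (stop (step s)).
  by exists 1%N, (step s); split; [apply: repeat_stop|apply: hinv|].
rewrite iterSr => /(IH _ (hinv _ hs))[N [s' [h1 h2 h3]]].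
by exists N.+1, s'; split=> //; apply: repeat_next.
Qed.

Lemma repeat_until_stop s N s' : repeat_until step stop s N s' -> stop s'.
Proof. by elim. Qed.

Lemma repeat_until_det s N s' M s'' : repeat_until step stop s N s' ->
  repeat_until step stop s M s'' -> N = M /\ s' = s''.
Proof.
move=> h; elim: h M s'' => {s N s'} [s st|s N s' nst h IH] M s'' h2.
  by inversion h2.
inversion h2; first by [].
by have [-> ->] := IH _ _ H0.
Qed.

End Loop.

(** * Linear convergence of the perturbed dynamics *)

Section Convergence.
Context {R : realType}.
Implicit Types d m n : nat.

Section Stepx.
Variables (m n : nat) (A : 'M[R]_(m, n)) (X : set 'cV[R]_m) (Y : set 'cV[R]_n).
Variables (eta mu : R).
Hypotheses (pX : polytope X) (X0 : X !=set0) (pY : polytope Y) (Y0 : Y !=set0).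
Hypotheses (eta0 : 0 < eta) (mu0 : 0 < mu).

Let cX : compact_convex X. Proof. exact: polytope_compact_convex. Qed.
Let cY : compact_convex Y. Proof. exact: polytope_compact_convex. Qed.

Lemma stepx_in z : X (stepx A X Y eta mu z).1 /\ Y (stepx A X Y eta mu z).2.
Proof. by split; apply: proj_in. Qed.

Lemma stepxP x y x' y' (z := stepx A X Y eta mu (x, y)) : X x' -> Y y' ->
  dotv (z.1 - x) (z.1 - x') <= eta * dotv (A *m y + mu *: x) (x' - z.1) /\
  dotv (z.2 - y) (z.2 - y') <= eta * dotv (A^T *m z.1) (z.2 - y').
Proof.
move=> Xx' Yy'; rewrite {}/z /stepx/=.
have [_ _ _ coX] := cX; have [_ _ _ coY] := cY.
have := proj_obtuse coX (projP (x - eta *: (A *m y + mu *: x)) cX) Xx'.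
move: (Defs.proj X _) => p hp.
have := proj_obtuse coY (projP (y + eta *: (A^T *m p)) cY) Yy'.
move: (Defs.proj Y _) => q; move: hp; rewrite !dotvE => h1 h2.
by split; lra.
Qed.

(** Adding the optimality conditions of both projections to those of the saddle point, the
bilinear terms cancel except for [<A (q - y), p - xs>], which remains because the
step in [x] uses the old [y].  Young's inequality splits that term between
[|q - y|^2] and the strong convexity gain [mu |p - xs|^2]; a positive weight is
left on [|q - y|^2] when [eta |A|^2 < mu]. *)
Lemma stepx_descent x y xs ys (z := stepx A X Y eta mu (x, y)) :
  X x -> Y y -> saddle A X Y mu xs ys ->
  l2norm (z.1 - xs) ^+ 2 + l2norm (z.2 - ys) ^+ 2 <=
  l2norm (x - xs) ^+ 2 + l2norm (y - ys) ^+ 2 -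
  ((1 - eta * mu) * l2norm (z.1 - x) ^+ 2 +
   (1 - eta * frob A ^+ 2 / mu) * l2norm (z.2 - y) ^+ 2 +
   eta * mu * l2norm (x - xs) ^+ 2).
Proof.
move=> Xx Yy [Xxs Yys sx sy]; rewrite {}/z.
have [Xp Yq] := stepx_in (x, y); have [] := stepxP x y Xxs Yys.
move: (stepx _ _ _ _ _ _) Xp Yq => [p q]/= Xp Yq h1 h2.
have h3 : 0 <= eta * dotv (A *m ys + mu *: xs) (p - xs).
  by rewrite mulr_ge0 ?sx// ltW.
have h4 : 0 <= eta * dotv (A^T *m xs) (ys - q) by rewrite mulr_ge0 ?sy// ltW.
have h5 : 2 * (eta * dotv (A *m (q - y)) (p - xs)) <=
    eta * frob A ^+ 2 / mu * l2norm (q - y) ^+ 2 + eta * mu * l2norm (p - xs) ^+ 2.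
  have : dotv (A *m (q - y)) (p - xs) <= frob A * l2norm (q - y) * l2norm (p - xs).
    rewrite (le_trans (CauchySchwarz_dotv _ _))// ler_wpM2r ?l2norm_ge0//.
    exact: l2norm_mulmx.
  move: (l2norm (q - y)) (l2norm (p - xs)) (dotv _ _) => w r s hs.
  have : 0 <= eta / mu * (frob A * w - mu * r) ^+ 2.
    by rewrite mulr_ge0 ?sqr_ge0// divr_ge0 ?ltW.
  have -> : eta / mu * (frob A * w - mu * r) ^+ 2 = eta * frob A ^+ 2 / mu * w ^+ 2
     + eta * mu * r ^+ 2 - 2 * (eta * (frob A * w * r)).
    by field; rewrite gt_eqF.
  have : eta * s <= eta * (frob A * w * r) by rewrite ler_pM2l.
  lra.
rewrite !sqr_l2norm in h5 *.
set k := eta * frob A ^+ 2 / mu in h5 *.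
rewrite mulmxBr in h5; rewrite !dotvE -!dotv_mulmx in h1 h2 h3 h4 h5 *.
rewrite !(dotvC (A *m _)) in h1 h2 h3 h4 h5 *.
rewrite (dotvC x p) (dotvC x xs) (dotvC p xs) in h1 h2 h3 h4 h5 *.
rewrite (dotvC y q) (dotvC y ys) (dotvC q ys) in h1 h2 h3 h4 h5 *.
lra.
Qed.

End Stepx.
End Convergence.

Section Rate.
Context {R : realType}.
Variables (m n : nat) (A : 'M[R]_(m, n)) (X : set 'cV[R]_m) (Y : set 'cV[R]_n).
Variables (eta mu : R).
Hypotheses (pX : polytope X) (X0 : X !=set0) (pY : polytope Y) (Y0 : Y !=set0).
Hypotheses (eta0 : 0 < eta) (mu0 : 0 < mu).

Let cX : compact_convex X. Proof. exact: polytope_compact_convex. Qed.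
Let cY : compact_convex Y. Proof. exact: polytope_compact_convex. Qed.

Lemma l2bounded2 : exists2 M, 0 < M &
  (forall x, X x -> l2norm x <= M) /\ (forall y, Y y -> l2norm y <= M).
Proof.
have [_ bX] := pX; have [_ bY] := pY.
have [M M0 hM] := l2bounded bX; have [M' M'0 hM'] := l2bounded bY.
exists (M + M'); first exact: addr_gt0.
by split=> v Sv; [have := hM _ Sv|have := hM' _ Sv]; lra.
Qed.

(** If one pass hardly moves [(x, y)] and [x] is close to [xs], then [y] almost
satisfies the conditions that make [(xs, y)] a saddle point: the optimality
conditions of the two projections at [(p, q)] are, up to errors proportional
to the moves, those conditions. *)
Lemma stepx_residual xs ys : saddle A X Y mu xs ys ->
  exists2 K, 0 < K & forall x y (z := stepx A X Y eta mu (x, y)), X x -> Y y ->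
    let e := K * (l2norm (z.1 - x) + l2norm (z.2 - y) + l2norm (x - xs)) in
    (forall x', X x' -> dotv (A *m y + mu *: xs) (xs - x') <= e) /\
    (forall y', Y y' -> dotv (A^T *m xs) (y' - y) <= e).
Proof.
move=> [Xxs Yys _ _].
have [M M0 [hX hY]] := l2bounded2.
set F := frob A; set F' := frob A^T.
have F0 : 0 <= F by exact: frob_ge0.
have F'0 : 0 <= F' by exact: frob_ge0.
have Me : 0 < M / eta by rewrite divr_gt0.
exists (2 * (M / eta) + (F * M + mu * M) + 2 * (mu * M) + 2 * (M * F') + F' * M).
  have : 0 <= F * M by rewrite mulr_ge0// ltW.
  have : 0 <= F' * M by rewrite mulr_ge0// ltW.
  have : 0 < mu * M by rewrite mulr_gt0.
  lra.
move=> x y z Xx Yy; rewrite /z.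
have [Xp Yq] := stepx_in A eta mu pX X0 pY Y0 (x, y).
have hs x' y' := @stepxP R _ _ A X Y eta mu pX X0 pY Y0 x y x' y'.
move: hs Xp Yq.
move: (stepx _ _ _ _ _ _) => [p q]/= hs Xp Yq.
set dx := l2norm (p - x); set dy := l2norm (q - y); set ex := l2norm (x - xs).
have dx0 : 0 <= dx by exact: l2norm_ge0.
have dy0 : 0 <= dy by exact: l2norm_ge0.
have ex0 : 0 <= ex by exact: l2norm_ge0.
have px : l2norm (xs - p) <= ex + dx.
  by rewrite l2normB (le_trans (l2norm_dist p x xs))// addrC.
split=> [x' Xx'|y' Yy'].
  have [h _] := hs _ _ Xx' Yys.
  have h1 : dotv (A *m y + mu *: x) (p - x') <= dx * (M + M) / eta.
    rewrite ler_pdivlMr//.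
    have : dotv (x - p) (p - x') <= dx * (M + M).
      by apply: dotv_le; [rewrite l2normB|rewrite l2normB_le ?hX].
    have -> : dotv (x - p) (p - x') = - dotv (p - x) (p - x') by rewrite -dotvNl opprB.
    have -> : dotv (A *m y + mu *: x) (p - x') = - dotv (A *m y + mu *: x) (x' - p).
      by rewrite -dotvNr opprB.
    lra.
  have h2 : dotv (A *m y + mu *: x) (xs - p) <= (F * M + mu * M) * (ex + dx).
    apply: dotv_le => //; apply: l2normD_le; first by rewrite l2norm_mulmx_le ?hY.
    by rewrite l2normZ_le ?hX.
  have h3 : mu * dotv (xs - x) (xs - x') <= mu * (ex * (M + M)).
    by rewrite ler_pM2l// dotv_le// ?l2normB_le ?hX// l2normB.
  have E : dotv (A *m y + mu *: xs) (xs - x') =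
      dotv (A *m y + mu *: x) (p - x') + dotv (A *m y + mu *: x) (xs - p)
      + mu * dotv (xs - x) (xs - x') by rewrite !dotvE; ring.
  rewrite E.
  have : dx * (M + M) / eta = 2 * (M / eta) * dx by ring.
  have : 0 <= (F * M + mu * M) * dy by rewrite mulr_ge0// addr_ge0// mulr_ge0// ltW.
  have : 0 <= mu * M * (dx + dy) by rewrite mulr_ge0 ?addr_ge0// ltW// mulr_gt0.
  have : 0 <= M / eta * (dy + ex) by rewrite mulr_ge0 ?addr_ge0// ltW.
  have : 0 <= F' * M * (dx + dy + ex) by rewrite mulr_ge0 ?addr_ge0// mulr_ge0// ltW.
  lra.
have [_ h] := hs _ _ Xxs Yy'.
have h1 : dotv (A^T *m p) (y' - q) <= dy * (M + M) / eta.
  rewrite ler_pdivlMr//.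
  have : dotv (y - q) (q - y') <= dy * (M + M).
    by apply: dotv_le; [rewrite l2normB|rewrite l2normB_le ?hY].
  have -> : dotv (y - q) (q - y') = - dotv (q - y) (q - y') by rewrite -dotvNl opprB.
  have -> : dotv (A^T *m p) (y' - q) = - dotv (A^T *m p) (q - y').
    by rewrite -dotvNr opprB.
  lra.
have h2 : dotv (A^T *m (xs - p)) (y' - q) <= F' * (ex + dx) * (M + M).
  by apply: dotv_le; [exact: l2norm_mulmx_le|rewrite l2normB_le ?hY].
have h3 : dotv (A^T *m xs) (q - y) <= F' * M * dy.
  by apply: dotv_le => //; rewrite l2norm_mulmx_le ?hX.
have -> : dotv (A^T *m xs) (y' - y) = dotv (A^T *m p) (y' - q) +
    dotv (A^T *m (xs - p)) (y' - q) + dotv (A^T *m xs) (q - y).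
  by rewrite mulmxBr !dotvE; ring.
have : dy * (M + M) / eta = 2 * (M / eta) * dy by ring.
have : 0 <= (F * M + mu * M) * (dx + dy + ex).
  by rewrite mulr_ge0 ?addr_ge0// mulr_ge0// ltW.
have : 0 <= mu * M * (dx + dy + ex) by rewrite mulr_ge0 ?addr_ge0// ltW// mulr_gt0.
have : 0 <= M / eta * (dx + ex) by rewrite mulr_ge0 ?addr_ge0// ltW.
have : 0 <= M * F' * dy by rewrite mulr_ge0// mulr_ge0// ltW.
have : 0 <= F' * M * (dx + ex) by rewrite mulr_ge0 ?addr_ge0// mulr_ge0// ltW.
lra.
Qed.

(** For fixed [xs] the saddle conditions on [y] are linear inequalities.  By
[polytope_faces] the family indexed by [x'] may be restricted to finitely many points,
and optimality of [y] against [xs] is a single inequality because the optimal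
payoff is known from [ys0].  So Hoffman's bound applies. *)
Lemma saddle_error_bound xs ys0 : saddle A X Y mu xs ys0 ->
  exists2 kappa, 0 < kappa & forall y e, Y y -> 0 <= e ->
    (forall x', X x' -> dotv (A *m y + mu *: xs) (xs - x') <= e) ->
    (forall y', Y y' -> dotv (A^T *m xs) (y' - y) <= e) ->
    exists ys, [/\ saddle A X Y mu xs ys, l2norm (y - ys) <= kappa * e &
      forall ys', saddle A X Y mu xs ys' -> l2norm (y - ys) <= l2norm (y - ys')].
Proof.
move=> [Xxs Yys0 sx0 sy0].
have [T [w [Xw hw]]] := polytope_faces pX X0.
pose b (j : T + unit) := match j with
  inl i => A^T *m (xs - w i) | inr _ => - (A^T *m xs) end.
pose c (j : T + unit) := match j with
  inl i => - dotv (mu *: xs) (xs - w i) | inr _ => - dotv (A^T *m xs) ys0 end.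
have bE y j : dotv (b j) y - c j = match j with
    inl i => dotv (A *m y + mu *: xs) (xs - w i) |
    inr _ => dotv (A^T *m xs) (ys0 - y) end.
  case: j => [i|[]] /=; rewrite opprK !dotvE; last ring.
  by rewrite mulmxBr dotvBl -!dotv_mulmx !(dotvC (A *m _)); ring.
have sadE ys : saddle A X Y mu xs ys <-> (Y `&` halfspaces b c) ys.
  split=> [[_ Yys sx sy]|[Yys h]].
    split=> // j; rewrite -subr_le0 bE; case: j => [i|_].
      by rewrite -oppr_ge0 -dotvNr opprB sx.
    by rewrite -oppr_ge0 -dotvNr opprB sy.
  split=> // [x' Xx'|y' Yy'].
    have [i hi] := hw (- (A *m ys + mu *: xs)) x' Xx'.
    have := h (inl i); rewrite -subr_le0 bE; move: hi.
    rewrite !dotvNl !(dotvBr _ _ (A *m ys + mu *: xs)); lra.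
  have := h (inr tt); rewrite -subr_le0 bE; have := sy0 y' Yy'.
  rewrite !dotvBr; lra.
have cS : compact_convex (Y `&` halfspaces b c).
  by apply: compact_convexI => //; exists ys0; apply/sadE; split.
have [kappa k0 hk] := polyhedron_hoffman b c (proj1 pY).
exists kappa => // y e Yy e0 h1 h2.
have hp := projP y cS; have [Sp hmin] := hp.
exists (Defs.proj (Y `&` halfspaces b c) y); split.
- exact/sadE.
- apply: hk hp e0 _ => // j; rewrite bE; case: j => [i|_]; first exact: h1.
  exact: h2.
- by move=> ys' /sadE; exact: hmin.
Qed.

Definition near_saddle r (z : 'cV[R]_m * 'cV[R]_n) := exists xs ys,
  saddle A X Y mu xs ys /\ l2norm (z.1 - xs) ^+ 2 + l2norm (z.2 - ys) ^+ 2 <= r.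

(** Strong convexity in [x]: exchanging the two saddle points in their variational
inequalities leaves [mu |xs - xs'|^2 <= 0]. *)
Lemma saddle_x_unique xs ys xs' ys' :
  saddle A X Y mu xs ys -> saddle A X Y mu xs' ys' -> xs = xs'.
Proof.
move=> [Xx Yy sx sy] [Xx' Yy' sx' sy'].
have := sx _ Xx'; have := sx' _ Xx; have := sy _ Yy'; have := sy' _ Yy.
move=> h1 h2 h3 h4; apply/eqP; rewrite -subr_eq0 -dotvv_eq0 eq_le dotvv_ge0 andbT.
rewrite -(pmulr_rle0 _ mu0); move: h1 h2 h3 h4.
rewrite !dotvE -!dotv_mulmx !(dotvC (A *m _)) (dotvC xs' xs); lra.
Qed.

Hypotheses (eta_mu : eta * mu < 1) (eta_A : eta * frob A ^+ 2 < mu).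

(** [stepx_descent] removes a multiple [c] of the squared residual [S], and
[saddle_error_bound] with [stepx_residual] makes [S] at least a fraction [1 / B] of
the squared distance [D] to the nearest saddle point.  That point may change
from pass to pass, which is why [near_saddle] does not fix it. *)
Lemma stepx_contraction : exists rho, [/\ 0 <= rho, rho < 1 &
  forall z r, X z.1 -> Y z.2 -> near_saddle r z ->
    near_saddle (rho * r) (stepx A X Y eta mu z)].
Proof.
have [xs [ys0 s0]] := saddle_exists A cX cY mu0.
have [K K0 hK] := stepx_residual s0.
have [kappa k0 hkap] := saddle_error_bound s0.
pose c := Num.min (eta * mu) (Num.min (1 - eta * mu) (1 - eta * frob A ^+ 2 / mu)).
have c0 : 0 < c.
  by rewrite !lt_min mulr_gt0// !subr_gt0 eta_mu/= ltr_pdivrMr// mul1r.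
have c1 : c < 1 by rewrite gt_min eta_mu.
have [cl1 cl2 cl3] : [/\ c <= eta * mu, c <= 1 - eta * mu &
    c <= 1 - eta * frob A ^+ 2 / mu].
  by split; rewrite ?ge_min ?lexx ?orbT.
pose B := 1 + 3 * (kappa * K) ^+ 2.
have B1 : 1 <= B by rewrite lerDl mulr_ge0// sqr_ge0.
have B0 : 0 < B by exact: lt_le_trans B1.
exists (1 - c / B); split.
- by rewrite subr_ge0 ler_pdivrMr// mul1r (le_trans (ltW c1)).
- by rewrite ltrBlDr ltrDl divr_gt0.
move=> [x y] r/= Xx Yy [xs' [ys' [s' hr]]].
have Exs := saddle_x_unique s' s0; subst xs'.
have [h1 h2] := hK x y Xx Yy.
have [] := hkap y _ Yy _ h1 h2.
  by rewrite mulr_ge0 ?addr_ge0 ?l2norm_ge0// ltW.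
move=> ys [sys ybound ymin].
have := stepx_descent pX X0 pY Y0 eta0 mu0 Xx Yy sys.
have := ymin _ s'; move: hr ybound {h1 h2 ymin}.
move: (stepx _ _ _ _ _ _) => [p q]/= hr ybound ymin hd.
exists xs, ys; split=> //=; apply: (le_trans hd).
move: (l2norm_ge0 (p - x)) (l2norm_ge0 (q - y)) (l2norm_ge0 (x - xs)).
move: (l2norm_ge0 (y - ys)) hr ybound ymin.
move: (l2norm (p - x)) (l2norm (q - y)) (l2norm (x - xs)).
move: (l2norm (y - ys)) (l2norm (y - ys')).
move=> ey ey' dx dy ex ey0 hr hey heyy' dx0 dy0 ex0.
set S := dx ^+ 2 + dy ^+ 2 + ex ^+ 2.
set D := ex ^+ 2 + ey ^+ 2.
have DB : D <= B * S.
  have : ey ^+ 2 <= (kappa * K) ^+ 2 * (dx + dy + ex) ^+ 2.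
    rewrite -exprMn ler_pXn2r ?nnegrE//; first by rewrite -mulrA.
    by rewrite mulr_ge0 ?addr_ge0// ltW// mulr_gt0.
  have : (dx + dy + ex) ^+ 2 <= 3 * S.
    have := sqr_ge0 (dx - dy); have := sqr_ge0 (dx - ex); have := sqr_ge0 (dy - ex).
    rewrite /S; lra.
  move=> /(ler_wpM2l (sqr_ge0 (kappa * K))) h1 h2.
  have : 0 <= dx ^+ 2 + dy ^+ 2 by rewrite addr_ge0 ?sqr_ge0.
  rewrite /D /B /S in h1 *; lra.
have DS : c / B * D <= c * S.
  by rewrite -mulrA ler_pM2l// mulrC ler_pdivrMr// mulrC.
have h3 : c * S <= (1 - eta * mu) * dx ^+ 2 + (1 - eta * frob A ^+ 2 / mu) * dy ^+ 2
    + eta * mu * ex ^+ 2.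
  by rewrite /S !mulrDr !lerD// ler_wpM2r// sqr_ge0.
have Dr : D <= r.
  apply: le_trans hr; rewrite lerD2l ler_pXn2r ?nnegrE//.
  exact: le_trans heyy'.
have rho0 : 0 <= 1 - c / B.
  by rewrite subr_ge0 ler_pdivrMr// mul1r (le_trans (ltW c1)).
have := ler_wpM2l rho0 Dr; rewrite -/D; lra.
Qed.

(** The gap tested by the stopping rule is nonpositive at a saddle point and
Lipschitz on bounded sets. *)
Lemma stopx_near_saddle : exists2 G, 0 < G & forall z s, X z.1 -> Y z.2 ->
  0 <= s -> near_saddle (s ^+ 2) z -> stopx A X Y mu (G * s) z.
Proof.
have [M M0 [hX hY]] := l2bounded2.
set F := frob A; set F' := frob A^T.
have F0 : 0 <= F by exact: frob_ge0.
have F'0 : 0 <= F' by exact: frob_ge0.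
have muM : 0 < mu * M by rewrite mulr_gt0.
have FM : 0 <= F * M by rewrite mulr_ge0// ltW.
have F'M : 0 <= F' * M by rewrite mulr_ge0// ltW.
exists ((F * M + mu * M) + (F + mu) * (M + M) + F' * M + F' * (M + M)); first lra.
move=> [x y] s/= Xx Yy s_ge0 [xs [ys [[Xxs Yys sx sy]/=]]].
set ex := l2norm (x - xs); set ey := l2norm (y - ys) => hs.
have ex_s : ex <= s.
  rewrite -(@ler_pXn2r _ 2) ?nnegrE ?l2norm_ge0//.
  by have := sqr_ge0 ey; lra.
have ey_s : ey <= s.
  rewrite -(@ler_pXn2r _ 2) ?nnegrE ?l2norm_ge0//.
  by have := sqr_ge0 ex; lra.
apply: vi_gap_le => // x' y' Xx' Yy' /=.
have h1 := sx _ Xx'; have h2 := sy _ Yy'.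
have h3 : dotv (A *m ys + mu *: xs) (x - xs) <= (F * M + mu * M) * s.
  apply: dotv_le => //; apply: l2normD_le; first by rewrite l2norm_mulmx_le ?hY.
  by rewrite l2normZ_le ?hX.
have h4 : dotv (A *m (y - ys) + mu *: (x - xs)) (x - x') <= (F * s + mu * s) * (M + M).
  apply: dotv_le; last by rewrite l2normB_le ?hX.
  by apply: l2normD_le; [exact: l2norm_mulmx_le|exact: l2normZ_le].
have h5 : dotv (A^T *m xs) (ys - y) <= F' * M * s.
  by apply: dotv_le; rewrite ?l2norm_mulmx_le ?hX// l2normB.
have h6 : dotv (A^T *m (xs - x)) (y - y') <= F' * s * (M + M).
  apply: dotv_le; last by rewrite l2normB_le ?hY.
  by apply: l2norm_mulmx_le; rewrite l2normB.
move: h1 h2 h3 h4 h5 h6; rewrite !mulmxBr !dotvE; lra.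
Qed.

Lemma near_saddle_init : exists2 D, 0 < D & forall z, X z.1 -> Y z.2 ->
  near_saddle (D ^+ 2) z.
Proof.
have [M M0 [hX hY]] := l2bounded2.
have [xs [ys s0]] := saddle_exists A cX cY mu0.
exists (4 * M); first by rewrite mulr_gt0.
move=> [x y]/= Xx Yy; exists xs, ys; split=> //=.
have [Xxs Yys _ _] := s0.
have h1 : l2norm (x - xs) ^+ 2 <= (M + M) ^+ 2.
  by rewrite ler_pXn2r ?nnegrE ?l2norm_ge0 ?l2normB_le ?hX// addr_ge0// ltW.
have h2 : l2norm (y - ys) ^+ 2 <= (M + M) ^+ 2.
  by rewrite ler_pXn2r ?nnegrE ?l2norm_ge0 ?l2normB_le ?hY// addr_ge0// ltW.
have := sqr_ge0 M; lra.
Qed.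

End Rate.

Section Powers.
Context {R : realType}.

Lemma exp_small (q e : R) : 0 <= q -> q < 1 -> 0 < e ->
  exists a, forall t, (a <= t)%N -> q ^+ t <= e.
Proof.
move=> q0 q1 e0; have : `|q| < 1 by rewrite ger0_norm.
move=> /cvg_expr/cvgrPdist_lt/(_ e e0)[a _ ha]; exists a => t /ha.
by rewrite /= sub0r normrN ger0_norm ?exprn_ge0// => /ltW.
Qed.

(** [e <= 1/2] keeps [ln (1 / e)] above [ln 2], so that rounding up costs only a
constant factor. *)
Lemma log_exponent (e : R) : 0 < e -> e <= 1 / 2 ->
  exists s, [/\ (0 < s)%N, expR (-1) ^+ s <= e &
    s%:R <= (1 + (ln 2)^-1) * ln (1 / e)].
Proof.
move=> e0 e2; have ln20 : 0 < ln 2 :> R by rewrite ln_gt0// ltr1n.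
set L := ln (1 / e).
have eL : e = expR (- L) by rewrite expRN lnK ?posrE ?div1r ?invr_gt0// invrK.
have L2 : ln 2 <= L.
  rewrite ler_ln ?posrE ?divr_gt0// ler_pdivlMr//; lra.
have L0 : 0 <= L by rewrite (le_trans _ L2)// ltW.
exists (Num.trunc L).+1; have /andP[t1 t2] := truncn_itv L0; split=> //.
  by rewrite -expRM_natr mulN1r eL ler_expR lerN2 ltW.
have : 1 <= (ln 2)^-1 * L by rewrite mulrC ler_pdivlMr// mul1r.
rewrite -natr1; lra.
Qed.
End Powers.

Section Linear.
Context {R : realType}.
Variables (m n : nat) (A : 'M[R]_(m, n)) (X : set 'cV[R]_m) (Y : set 'cV[R]_n).
Variables (eta mu : R).
Hypotheses (pX : polytope X) (X0 : X !=set0) (pY : polytope Y) (Y0 : Y !=set0).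
Hypotheses (eta0 : 0 < eta) (mu0 : 0 < mu).
Hypotheses (eta_mu : eta * mu < 1) (eta_A : eta * frob A ^+ 2 < mu).

(** By [stepx_contraction] the distance to the saddle points decays geometrically,
and the gap is proportional to it, so it falls below [c e^2] after a number of
passes proportional to [ln (1 / e)].  [X] and [Y] being bounded, the constant is
the same for all starting points. *)
Lemma asymp_gda_x_linear c : 0 < c -> exists2 C, 0 < C &
  forall e delta z, 0 < e -> e <= 1 / 2 -> c * e ^+ 2 <= delta -> X z.1 -> Y z.2 ->
    exists N z', [/\ asymp_gda_x A X Y eta mu delta z N z', X z'.1, Y z'.2 &
      N%:R <= C * ln (1 / e)].
Proof.
move=> c0.
have [rho [rho0 rho1 hrho]] := stepx_contraction pX X0 pY Y0 eta0 mu0 eta_mu eta_A.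
have [D D0 hD] := near_saddle_init A pX X0 pY Y0 mu0.
have [G G0 hG] := stopx_near_saddle A pX X0 pY Y0 mu0.
(* [a] passes shrink the squared distance by [q^4], that is the gap by [q^2];
   [2 b] powers of [q] absorb the constants and [2 s] of them give [e^2] *)
pose q : R := expR (-1).
have q0 : 0 < q by exact: expR_gt0.
have q1 : q < 1 by rewrite -expR0 ltr_expR ltrN10.
have [a ha] := exp_small rho0 rho1 (exprn_gt0 4 q0).
have [b hb] : exists b, q ^+ (2 * b) * (G * D) <= c.
  have q2 : q ^+ 2 < 1 by rewrite expr_lt1// ltW.
  have [b hb] := exp_small (sqr_ge0 q) q2 (divr_gt0 c0 (mulr_gt0 G0 D0)).
  by exists b; rewrite exprM -ler_pdivlMr ?mulr_gt0// hb.
have ln20 : 0 < ln 2 :> R by rewrite ln_gt0// ltr1n.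
exists ((a * (b + 1) + 1)%:R * (1 + (ln 2)^-1)).
  by rewrite mulr_gt0 ?addr_gt0 ?invr_gt0// ltr0n addn1.
move=> e delta z e0 e2 hdelta Xz Yz.
have [s [s0 qs hs]] := log_exponent e0 e2.
set t := (a * (b + s))%N.
have hit k : [/\ X (iter k (stepx A X Y eta mu) z).1,
    Y (iter k (stepx A X Y eta mu) z).2 &
    near_saddle A X Y mu (rho ^+ k * D ^+ 2) (iter k (stepx A X Y eta mu) z)].
  elim: k => [|k [IH1 IH2 IH3]] /=; first by split=> //; rewrite mul1r; exact: hD.
  have [h1 h2] := stepx_in A eta mu pX X0 pY Y0 (iter k (stepx A X Y eta mu) z).
  by split=> //; rewrite exprS -mulrA; exact: hrho.
have [|N [z' [run [Xz' Yz'] Nt]]] := repeat_until_reached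
  (stop := stopx A X Y mu delta) (inv := fun z => X z.1 /\ Y z.2) (t := t)
  (conj Xz Yz) (fun z _ => stepx_in A eta mu pX X0 pY Y0 z).
  have [Xt Yt [xs [ys [sxy hn]]]] := hit t.+1.
  have pw : rho ^+ t.+1 * D ^+ 2 <= (q ^+ (2 * (b + s)) * D) ^+ 2.
    rewrite exprMn ler_wpM2r ?sqr_ge0// exprS.
    apply: (@le_trans _ _ (rho ^+ t)); first by rewrite ler_piMl ?exprn_ge0// ltW.
    rewrite -[leRHS]exprM mulnAC (exprM q (2 * 2)) /t exprM.
    by apply: lerXn2r; rewrite ?nnegrE ?exprn_ge0 ?(ltW q0)//; exact: ha.
  have := hG _ (q ^+ (2 * (b + s)) * D) Xt Yt.
  have qD : 0 <= q ^+ (2 * (b + s)) * D by rewrite mulr_ge0 ?exprn_ge0// ltW.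
  move=> /(_ qD (ex_intro _ xs (ex_intro _ ys (conj sxy (le_trans hn pw))))).
  rewrite /stopx => /le_trans; apply; apply: le_trans hdelta.
  rewrite mulnDr exprD.
  have -> : G * (q ^+ (2 * b) * q ^+ (2 * s) * D) = q ^+ (2 * b) * (G * D) * (q ^+ s) ^+ 2.
    by rewrite -exprM (mulnC s); ring.
  apply: ler_pM; rewrite ?mulr_ge0 ?exprn_ge0 ?(ltW q0) ?(ltW G0) ?(ltW D0)//.
  by apply: lerXn2r; rewrite ?nnegrE ?exprn_ge0 ?(ltW q0) ?(ltW e0).
exists N, z'; split=> //.
have : N%:R <= ((a * (b + 1) + 1) * s)%:R :> R.
  rewrite ler_nat (leq_trans Nt)// /t -addn1 mulnDl mul1n leq_add// -mulnA leq_mul//.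
  by rewrite mulnDl mul1n leq_add2r leq_pmulr.
move=> /le_trans; apply; rewrite natrM -mulrA ler_wpM2l//.
Qed.

(** Strong monotonicity: testing the gap against the saddle point gives at least
[mu] times the squared distance of the [x] components. *)
Lemma stopx_close delta z xs ys : stopx A X Y mu delta z -> X z.1 -> Y z.2 ->
  saddle A X Y mu xs ys -> mu * l2norm (z.1 - xs) ^+ 2 <= delta.
Proof.
move: z => [x y]/= st Xx Yy [Xxs Yys sx sy]; apply: le_trans st => /=.
have [_ bX] := pX; have [_ bY] := pY.
have := vi_gap_ge (A *m y + mu *: x) (- (A^T *m x)) x y bX bY Xxs Yys.
have := sx _ Xx; have := sy _ Yy.
rewrite sqr_l2norm !dotvE -!dotv_mulmx !(dotvC (A *m _)) (dotvC xs x); lra.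
Qed.

End Linear.

(** * The largest singular value as an operator norm *)

Section Spec.
Context {R : realType}.

(** A maximiser [u] of [|A u|] on the unit sphere is an eigenvector of [A^T A]: the
quadratic form [lam |w|^2 - |A w|^2] is nonnegative and vanishes at [u], so its
gradient [g] there, up to a factor 2, is 0. *)
Lemma rayleigh_max m n (A : 'M[R]_(m, n)) : A != 0 -> exists (u : 'cV[R]_n) lam,
  [/\ u != 0, A^T *m A *m u = lam *: u &
    forall w, l2norm (A *m w) ^+ 2 <= lam * l2norm w ^+ 2].
Proof.
move=> A0.
have [k0 hk0] : exists v : 'cV[R]_n, l2norm v = 1.
  have [v v0] : exists v : 'cV[R]_n, v != 0.
    apply: contrapT => h; move/eqP: A0; apply.
    apply/matrixP => i j; exfalso; apply: h; exists (delta_mx j 0).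
    apply/eqP => /matrixP/(_ j 0); rewrite !mxE !eqxx => /eqP.
    by rewrite oner_eq0.
  exists ((l2norm v)^-1 *: v); rewrite l2normZ ger0_norm ?invr_ge0 ?l2norm_ge0//.
  by rewrite mulVf// gt_eqF// l2norm_gt0.
pose K : set 'cV[R]_n := [set v | l2norm v = 1].
have [||||u Ku umax] := @lipschitz_min _ _ (fun v => - l2norm (A *m v) ^+ 2) K
  (frob A * (frob A * (1 + 1))).
- by exists k0.
- exists 1; split=> // x x1 v /= v1.
  by rewrite (le_trans (norm_le_l2norm v))// v1 ltW.
- exact: l2closed_sphere.
- move=> u v u1 v1.
  have -> : - l2norm (A *m u) ^+ 2 - - l2norm (A *m v) ^+ 2 =
      dotv (A *m (v - u)) (A *m (v + u)).
    by rewrite !sqr_l2norm mulmxBr mulmxDr !dotvE (dotvC (A *m u) (A *m v)); ring.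
  rewrite mulrAC; apply: dotv_le; first by rewrite l2norm_mulmx_le// l2normB.
  by rewrite l2norm_mulmx_le// l2normD_le// ?u1 ?v1.
pose lam := l2norm (A *m u) ^+ 2.
have ray w : l2norm (A *m w) ^+ 2 <= lam * l2norm w ^+ 2.
  have [->|w0] := eqVneq w 0; first by rewrite mulmx0 !l2norm0 expr0n/= mulr0.
  have nw : 0 < l2norm w by rewrite l2norm_gt0.
  have := umax ((l2norm w)^-1 *: w).
  rewrite /K/= l2normZ ger0_norm ?invr_ge0 ?l2norm_ge0// mulVf ?gt_eqF// => /(_ erefl).
  rewrite -scalemxAr l2normZ ger0_norm ?invr_ge0 ?l2norm_ge0// lerN2 exprMn exprVn.
  by rewrite mulrC ler_pdivrMr// exprn_gt0.
exists u, lam; split=> //.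
  by rewrite -l2norm_gt0 Ku.
pose g := lam *: u - A^T *m A *m u.
suff : g == 0 by rewrite /g subr_eq0 => /eqP ->.
have Eg : A^T *m A *m u = lam *: u - g by rewrite /g opprB addrC subrK.
clearbody g; rewrite -dotvv_eq0 eq_le dotvv_ge0 andbT.
suff : 2 * dotv g g <= 0 by lra.
apply: (le0_small (t0 := 1) (b := lam * dotv g g - dotv (A *m g) (A *m g))) => // t t0 _.
have := ray (u - t *: g); rewrite !sqr_l2norm mulmxBr -scalemxAr !dotvE.
have E : dotv (A *m u) (A *m g) = lam * dotv u g - dotv g g.
  by rewrite dotv_mulmx mulmxA Eg dotvBl dotvZl.
rewrite (dotvC (A *m g) (A *m u)) E (dotvC g u).
have -> : dotv (A *m u) (A *m u) = lam by rewrite -sqr_l2norm.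
have -> : dotv u u = 1 by rewrite -sqr_l2norm Ku expr1n.
move=> h; rewrite -(ler_pM2l t0); lra.
Qed.

Lemma l2norm_specnorm m n (A : 'M[R]_(m, n)) v : A != 0 ->
  l2norm (A *m v) <= specnorm A * l2norm v.
Proof.
move=> /rayleigh_max[u [lam [u0 eig ray]]].
have lam0 : 0 <= lam.
  rewrite -(@pmulr_lge0 _ (l2norm u ^+ 2)) ?exprn_gt0 ?l2norm_gt0//.
  by rewrite (le_trans _ (ray u))// sqr_ge0.
have tr (w : 'rV[R]_n) a : (w *m (A^T *m A) = a *: w) -> A^T *m A *m w^T = a *: w^T.
  by move=> h; apply: trmx_inj; rewrite trmx_mul trmxK trmx_mul trmxK h linearZ/= trmxK.
apply: (@le_trans _ _ (Num.sqrt lam * l2norm v)).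
  rewrite -(@ler_pXn2r _ 2) ?nnegrE ?mulr_ge0 ?l2norm_ge0 ?sqrtr_ge0//.
  by rewrite exprMn (sqr_sqrtr lam0).
rewrite ler_wpM2r ?l2norm_ge0//; apply: ub_le_sup.
  exists (Num.sqrt lam) => _ [a /eigenvalueP[w hw w0] <-].
  apply: ler_wsqrtr; have wT : 0 < l2norm w^T ^+ 2.
    by rewrite exprn_gt0// l2norm_gt0 -(inj_eq (@trmx_inj _ _ _)) trmxK trmx0.
  have := ray w^T; rewrite (sqr_l2norm (A *m _)) dotv_mulmx mulmxA (tr _ _ hw).
  by rewrite dotvZl -sqr_l2norm ler_pM2r.
exists lam => //; apply/eigenvalueP; exists u^T; last first.
  by rewrite -(inj_eq (@trmx_inj _ _ _)) trmxK trmx0.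
by apply: trmx_inj; rewrite trmx_mul trmx_mul !trmxK eig linearZ/= trmxK.
Qed.

Lemma specnorm_gt0 m n (A : 'M[R]_(m, n)) : A != 0 -> 0 < specnorm A.
Proof.
move=> A0; rewrite ltNge; apply/negP => s0.
move/eqP: (A0); apply; apply/matrixP => i j.
have : l2norm (A *m delta_mx j 0) <= 0.
  rewrite (le_trans (l2norm_specnorm _ A0))// mulr_le0_ge0 ?l2norm_ge0//.
have := coord_le_l2norm (A *m delta_mx j 0) i.
rewrite -colE !mxE => h1 h2; apply/eqP; rewrite -normr_le0; exact: le_trans h1 h2.
Qed.

End Spec.

(** * Exchanging the players *)

Section Swap.
Context {R : realType}.
Variables (m n : nat) (A : 'M[R]_(m, n)) (X : set 'cV[R]_m) (Y : set 'cV[R]_n).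

Lemma repeat_until_map (T T' : Type) (f : T -> T') step stop step' stop' s N s' :
  (forall s, step' (f s) = f (step s)) -> (forall s, stop' (f s) <-> stop s) ->
  repeat_until step stop s N s' -> repeat_until step' stop' (f s) N (f s').
Proof.
move=> hs ht; elim=> {s N s'} [s st|s N s' nst _ IH].
  by rewrite -hs; apply: repeat_stop; rewrite hs; apply/ht.
by apply: repeat_next; rewrite hs// => /ht.
Qed.

Definition swap (T T' : Type) (z : T * T') := (z.2, z.1).

(** For the matrix [- A^T] the maximising player becomes the minimising one, so the
pass perturbed in [y] is the pass perturbed in [x] of that game. *)
Lemma stepy_swap eta mu z :
  stepy A X Y eta mu (swap z) = swap (stepx (- A^T) Y X eta mu z).
Proof.
case: z => y x; rewrite /stepy /stepx /swap /=.
have -> : y - eta *: (- A^T *m x + mu *: y) = y + eta *: (A^T *m x - mu *: y).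
  by rewrite mulNmx -scalerN opprD opprK.
by move: (Defs.proj Y _) => q; rewrite linearN/= trmxK mulNmx scalerN.
Qed.

Lemma stopy_swap mu delta z :
  stopy A X Y mu delta (swap z) <-> stopx (- A^T) Y X mu delta z.
Proof.
case: z => y x; rewrite /stopy /stopx /swap /= vi_gapC.
by rewrite linearN/= trmxK !mulNmx opprK.
Qed.

Lemma asymp_gda_y_swap eta mu delta z N z' :
  asymp_gda_x (- A^T) Y X eta mu delta z N z' ->
  asymp_gda_y A X Y eta mu delta (swap z) N (swap z').
Proof.
apply: repeat_until_map => [s|s]; [exact: stepy_swap|exact: stopy_swap].
Qed.

End Swap.

(** * The adaptive algorithm *)

Section Adaptive.
Context {R : realType}.
Variables (m n : nat) (A : 'M[R]_(m, n)) (X : set 'cV[R]_m) (Y : set 'cV[R]_n).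
Hypotheses (pX : polytope X) (X0 : X !=set0) (pY : polytope Y) (Y0 : Y !=set0).
Hypotheses (A0 : A != 0) (A1 : forall i j, `|A i j| <= 1).
Hypothesis Z0 : profiles X Y <> [set 0].
Variable mu_init : R.
Hypothesis mui0 : 0 < mu_init.

Let cX : compact_convex X. Proof. exact: polytope_compact_convex. Qed.
Let cY : compact_convex Y. Proof. exact: polytope_compact_convex. Qed.

Lemma adaptive_from_det eps k eta zx zy N x y N' x' y' :
  adaptive_from A X Y mu_init eps k eta zx zy N x y ->
  adaptive_from A X Y mu_init eps k eta zx zy N' x' y' -> N = N'.
Proof.
move=> h; elim: h N' x' y' => {k eta zx zy N x y}
  [k eta zx zy Nx Ny zx' zy' hx hy st|
   k eta zx zy Nx Ny zx' zy' N x y hx hy nst _ IH] N' x' y' h2; inversion h2; subst.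
- have [-> ?] := repeat_until_det hx H.
  by have [-> ?] := repeat_until_det hy H0.
- have [? ?] := repeat_until_det hx H; have [? ?] := repeat_until_det hy H0; subst.
  by case: H1.
- have [? ?] := repeat_until_det hx H; have [? ?] := repeat_until_det hy H0; subst.
  by case: nst.
- have [? ?] := repeat_until_det hx H; have [? ?] := repeat_until_det hy H0; subst.
  by rewrite (IH _ _ _ H2).
Qed.

Let W := sup [set l2norm z ^+ 2 | z in profiles X Y].

Lemma l2norm_col_mx (x : 'cV[R]_m) (y : 'cV[R]_n) :
  l2norm (col_mx x y) ^+ 2 = l2norm x ^+ 2 + l2norm y ^+ 2.
Proof.
rewrite !sqr_l2norm /dotv big_split_ord/=; congr (_ + _);
  by apply: eq_bigr => i _; rewrite ?col_mxEu ?col_mxEd.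
Qed.

Lemma profiles_norm_le x y : X x -> Y y -> l2norm x ^+ 2 + l2norm y ^+ 2 <= W.
Proof.
move=> Xx Yy; rewrite -l2norm_col_mx; apply: ub_le_sup; last first.
  by exists (col_mx x y) => //; split; rewrite ?col_mxKu ?col_mxKd.
have [M M0 [hX hY]] := l2bounded2 pX pY.
exists (M ^+ 2 + M ^+ 2) => _ [z [Xz Yz] <-].
rewrite -(vsubmxK z) l2norm_col_mx.
by apply: lerD; rewrite ler_pXn2r ?nnegrE ?l2norm_ge0 ?(ltW M0)//; [exact: hX|exact: hY].
Qed.

Lemma profiles_norm_gt0 : 0 < W.
Proof.
rewrite ltNge; apply/negP => W0; apply: Z0.
have [x0 Xx0] := X0; have [y0 Yy0] := Y0.
have hz z : profiles X Y z -> z = 0.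
  move=> [Xz Yz]; have := profiles_norm_le Xz Yz.
  rewrite -l2norm_col_mx vsubmxK => h; apply/eqP.
  rewrite -l2norm_eq0 -sqrf_eq0 eq_le sqr_ge0 andbT; exact: le_trans h W0.
apply/seteqP; split=> [z /hz //|_ ->].
have Pz : profiles X Y (col_mx x0 y0) by split; rewrite ?col_mxKu ?col_mxKd.
by rewrite -(hz _ Pz).
Qed.

Let mn0 : (0 < m * n)%N.
Proof.
rewrite lt0n; apply: contra A0 => mn; apply/eqP/matrixP => i j.
have im := leq_ltn_trans (leq0n i) (ltn_ord i).
have jn := leq_ltn_trans (leq0n j) (ltn_ord j).
by move: mn; rewrite muln_eq0 !eqn0Ngt im jn.
Qed.

Lemma mu_ep_gt0 k : 0 < mu_ep mu_init k.
Proof. by rewrite divr_gt0// exprn_gt0. Qed.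

(** The cap [mu / (mu^2 + mn)] on the step size is what makes both conditions
of [stepx_contraction] hold, [mn] being a bound for the squared Frobenius norm. *)
Lemma eta_epP eta k (eta' := eta_ep m n mu_init eta k) : 0 < eta ->
  [/\ 0 < eta', eta' * mu_ep mu_init k < 1 & eta' * (m * n)%:R < mu_ep mu_init k].
Proof.
move=> eta0; rewrite {}/eta' /eta_ep.
have := mu_ep_gt0 k; set mu := mu_ep _ _ => mu0.
have mnR : 0 < (m * n)%:R :> R by rewrite ltr0n.
have d0 : 0 < mu ^+ 2 + (m * n)%:R by rewrite addr_gt0// exprn_gt0.
have le1 : Num.min eta (mu / (mu ^+ 2 + (m * n)%:R)) <= mu / (mu ^+ 2 + (m * n)%:R).
  by rewrite ge_min lexx orbT.
split; first by rewrite lt_min eta0 divr_gt0.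
- apply: (le_lt_trans (ler_wpM2r (ltW mu0) le1)).
  by rewrite mulrAC ltr_pdivrMr// mul1r -expr2 ltrDl.
- apply: (le_lt_trans (ler_wpM2r (ltW mnR) le1)).
  by rewrite mulrAC ltr_pdivrMr// ltr_pM2l// ltrDr exprn_gt0.
Qed.

Lemma delta_epE eps k : delta_ep A X Y mu_init eps k =
  mu_ep mu_init k / (2 * specnorm A ^+ 2 * W) * eps ^+ 2.
Proof. by []. Qed.

Lemma delta_coef_gt0 k : 0 < mu_ep mu_init k / (2 * specnorm A ^+ 2 * W).
Proof.
by rewrite divr_gt0 ?mu_ep_gt0// !mulr_gt0 ?exprn_gt0 ?specnorm_gt0 ?profiles_norm_gt0.
Qed.

(** The cap at 1/2 makes the bound meaningful for every positive accuracy; a run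
that meets the smaller target also meets the larger one. *)
Definition log_target (eps : R) := ln (1 / Num.min eps (1 / 2)).

Lemma log_target_ge0 eps : 0 < eps -> 0 <= log_target eps.
Proof.
move=> e0; have m0 : 0 < Num.min eps (1 / 2) by rewrite lt_min e0 divr_gt0.
by rewrite ln_ge0// ler_pdivlMr// [leLHS]mul1r ge_min; apply/orP; right; lra.
Qed.

Lemma frob_trN : frob (- A^T) ^+ 2 <= (m * n)%:R.
Proof. by rewrite mulnC; apply: frob_le => i j; rewrite !mxE normrN. Qed.

Lemma episode_linear k eta : 0 < eta -> exists2 C, 0 < C &
  forall eps zx zy, 0 < eps -> X zx.1 -> Y zx.2 -> X zy.1 -> Y zy.2 ->
  exists Nx Ny zx' zy',
  [/\ asymp_gda_x A X Y (eta_ep m n mu_init eta k) (mu_ep mu_init k)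
        (delta_ep A X Y mu_init eps k) zx Nx zx',
      asymp_gda_y A X Y (eta_ep m n mu_init eta k) (mu_ep mu_init k)
        (delta_ep A X Y mu_init eps k) zy Ny zy',
      X zx'.1 /\ Y zx'.2, X zy'.1 /\ Y zy'.2 &
      (Nx + Ny)%:R <= C * log_target eps].
Proof.
move=> eta0; have [e0 e1 e2] := eta_epP k eta0; have mu0 := mu_ep_gt0 k.
have eF (p q : nat) (B : 'M[R]_(p, q)) : frob B ^+ 2 <= (m * n)%:R ->
    eta_ep m n mu_init eta k * frob B ^+ 2 < mu_ep mu_init k.
  by move=> h; apply: le_lt_trans e2; rewrite ler_wpM2l// ltW.
have [Cx Cx0 hx] := asymp_gda_x_linear pX X0 pY Y0 e0 mu0 e1
  (eF _ _ A (frob_le A1)) (delta_coef_gt0 k).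
have [Cy Cy0 hy] := asymp_gda_x_linear pY Y0 pX X0 e0 mu0 e1
  (eF _ _ _ frob_trN) (delta_coef_gt0 k).
exists (Cx + Cy) => [|eps zx zy eps0 Xzx Yzx Xzy Yzy]; first exact: addr_gt0.
pose e := Num.min eps (1 / 2).
have ee0 : 0 < e by rewrite lt_min eps0 divr_gt0.
have ee2 : e <= 1 / 2 by rewrite ge_min lexx orbT.
have ed : mu_ep mu_init k / (2 * specnorm A ^+ 2 * W) * e ^+ 2
    <= delta_ep A X Y mu_init eps k.
  rewrite delta_epE ler_wpM2l ?(ltW (delta_coef_gt0 k))//.
  by rewrite ler_pXn2r ?nnegrE ?(ltW ee0) ?(ltW eps0)// ge_min lexx.
have [Nx [zx' [rx Xx' Yx' Nxb]]] := hx _ _ _ ee0 ee2 ed Xzx Yzx.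
have [Ny [zy' [ry Yy' Xy' Nyb]]] := hy _ _ (swap zy) ee0 ee2 ed Yzy Xzy.
exists Nx, Ny, zx', (swap zy'); split=> //.
  by have := asymp_gda_y_swap ry; case: (zy).
by rewrite natrD mulrDl lerD.
Qed.

(** Once [mu] is small, [xs] and [ys] are exact minimax strategies by
[exact_penalty], and by [stopx_close] the stopping rules place the returned [x]
and [y] within [eps / (sqrt 2 |A| max |z|)] of them, so that by Cauchy-Schwarz the
gap is at most [eps]. *)
Lemma final_gap : exists2 mu1, 0 < mu1 & forall mu eps zx zy,
  0 < mu -> mu <= mu1 -> 0 < eps -> X zx.1 -> Y zx.2 -> X zy.1 -> Y zy.2 ->
  let delta := mu / (2 * specnorm A ^+ 2 * W) * eps ^+ 2 in
  stopx A X Y mu delta zx -> stopy A X Y mu delta zy ->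
  vi_gap X Y (A *m zy.2) (- (A^T *m zx.1)) zx.1 zy.2 <= eps.
Proof.
have [v hv] := minmax_value_exists A cX cY.
have [v' hv'] := minmax_value_exists (- A^T) cY cX.
have vv' := minimax cX cY hv hv'.
have [mua mua0 ha] := exact_penalty pX X0 pY Y0 hv.
have [mub mub0 hb] := exact_penalty pY Y0 pX X0 hv'.
exists (Num.min mua mub) => [|mu eps zx zy mu0]; first by rewrite lt_min mua0.
rewrite le_min => /andP[mua1 mub1] eps0 Xx Yx Xy Yy delta sx sy.
have [xs [ys1 s1]] := saddle_exists A cX cY mu0.
have [ys [xs2 s2]] := saddle_exists (- A^T) cY cX mu0.
have sy' : stopx (- A^T) Y X mu delta (swap zy).
  by apply/(stopy_swap A X Y); move: sy; case: (zy).
have hx := ha _ _ _ mu0 mua1 s1; have hy := hb _ _ _ mu0 mub1 s2.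
have dx := stopx_close pX pY sx Xx Yx s1.
have dy := stopx_close pY pX sy' Yy Xy s2.
rewrite /swap/= in dy.
move: dx dy hx hy; move: zx.1 Xx zy.2 Yy {sx sy sy'} => x Xx y Yy /=.
move=> dx dy hx hy.
apply: vi_gap_le => // x' y' Xx' Yy'.
set S := specnorm A.
have S0 : 0 < S by exact: specnorm_gt0.
have W0 := profiles_norm_gt0.
have e1 : dotv xs (A *m y') <= v by exact: hx.
have e2 : dotv ys (- A^T *m x') <= v' by exact: hy.
have e3 : dotv (x - xs) (A *m y') <= S * (l2norm (x - xs) * l2norm y').
  rewrite (le_trans (CauchySchwarz_dotv _ _))// mulrCA ler_wpM2l ?l2norm_ge0//.
  exact: l2norm_specnorm.
have e4 : dotv x' (A *m (ys - y)) <= S * (l2norm (y - ys) * l2norm x').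
  rewrite (le_trans (CauchySchwarz_dotv _ _))// (mulrC _ (l2norm x')) mulrCA.
  by rewrite ler_wpM2l ?l2norm_ge0// (l2normB y) l2norm_specnorm.
have e5 : S * (l2norm (x - xs) * l2norm y' + l2norm (y - ys) * l2norm x') <= eps.
  have hW := profiles_norm_le Xx' Yy'.
  have ge : 0 <= S * (l2norm (x - xs) * l2norm y' + l2norm (y - ys) * l2norm x').
    by rewrite mulr_ge0 ?(ltW S0)// addr_ge0// mulr_ge0 ?l2norm_ge0.
  rewrite -(@ler_pXn2r _ 2) ?nnegrE ?(ltW eps0)// exprMn.
  have hd a : mu * a <= delta -> a <= eps ^+ 2 / (2 * S ^+ 2 * W).
    rewrite /delta => h; rewrite -(ler_pM2l mu0); apply: (le_trans h).
    by rewrite mulrAC -mulrA.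
  have {}dx := hd _ dx; have {}dy := hd _ dy.
  set a := l2norm (x - xs) in dx *; set b := l2norm (y - ys) in dy *.
  have cs : (a * l2norm y' + b * l2norm x') ^+ 2 <=
     (a ^+ 2 + b ^+ 2) * (l2norm x' ^+ 2 + l2norm y' ^+ 2).
    have := sqr_ge0 (a * l2norm x' - b * l2norm y'); lra.
  have ab : a ^+ 2 + b ^+ 2 <= eps ^+ 2 / (S ^+ 2 * W).
    apply: (le_trans (lerD dx dy)); rewrite le_eqVlt; apply/orP; left; apply/eqP.
    by field; rewrite !gt_eqF.
  have le2 : (a ^+ 2 + b ^+ 2) * (l2norm x' ^+ 2 + l2norm y' ^+ 2) <=
      eps ^+ 2 / (S ^+ 2 * W) * W.
    by apply: ler_pM => //; rewrite addr_ge0 ?sqr_ge0.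
  have := ler_wpM2l (sqr_ge0 S) (le_trans cs le2).
  have -> : S ^+ 2 * (eps ^+ 2 / (S ^+ 2 * W) * W) = eps ^+ 2.
    by field; rewrite !gt_eqF.
  by [].
rewrite mulNmx dotvNr (dotv_mulmx _ ys) trmxK in e2.
move: e1 e2 e3 e4 e5; rewrite mulmxBr !dotvE -!dotv_mulmx !(dotvC (A *m _)); lra.
Qed.

Lemma mu_ep_small mu1 : 0 < mu1 -> exists K, forall k, (K <= k)%N ->
  mu_ep mu_init k <= mu1.
Proof.
move=> mu10.
have [||K hK] := @exp_small R 2^-1 (mu1 / mu_init) _ _ (divr_gt0 mu10 mui0); [lra|lra|].
exists K.+1 => k kK; rewrite /mu_ep mulrC -ler_pdivlMr// -exprVn.
by apply: hK; rewrite -ltnS (leq_trans kK)// leqSpred.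
Qed.

(** From some episode [K] on, which does not depend on [eps], the final test
succeeds.  So there are boundedly many episodes, each of logarithmic length; the
induction is on the number [K - k] of episodes that may remain. *)
Lemma adaptive_linear k eta : 0 < eta -> exists2 C, 0 < C &
  forall eps zx zy, 0 < eps -> X zx.1 -> Y zx.2 -> X zy.1 -> Y zy.2 ->
  exists N x y, [/\ adaptive_from A X Y mu_init eps k eta zx zy N x y,
    X x, Y y, vi_gap X Y (A *m y) (- (A^T *m x)) x y <= eps &
    N%:R <= C * log_target eps].
Proof.
have [mu1 mu10 fin] := final_gap; have [K hK] := mu_ep_small mu10.
move: {2}(K - k)%N (leqnn (K - k)) => j.
elim: j k eta => [|j IH] k eta hj eta0; have [C C0 hC] := episode_linear k eta0.
  exists C => // eps zx zy eps0 Xx Yx Xy Yy.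
  have [Nx [Ny [zx' [zy' [rx ry [Xx' Yx'] [Xy' Yy'] hN]]]]] := hC _ _ _ eps0 Xx Yx Xy Yy.
  have st : vi_gap X Y (A *m zy'.2) (- (A^T *m zx'.1)) zx'.1 zy'.2 <= eps.
    apply: (fin (mu_ep mu_init k)) => //; first exact: mu_ep_gt0.
    - by apply: hK; rewrite -subn_eq0 -leqn0.
    - exact: repeat_until_stop rx.
    - exact: repeat_until_stop ry.
  by exists (Nx + Ny)%N, zx'.1, zy'.2; split=> //; exact: adaptive_stop st.
have [||C' C'0 hC'] := IH k.+1 (eta_ep m n mu_init eta k).
  by rewrite subnS; case: (K - k)%N hj.
  by have [] := eta_epP k eta0.
exists (C + C') => [|eps zx zy eps0 Xx Yx Xy Yy]; first exact: addr_gt0.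
have [Nx [Ny [zx' [zy' [rx ry [Xx' Yx'] [Xy' Yy'] hN]]]]] := hC _ _ _ eps0 Xx Yx Xy Yy.
have L0 := log_target_ge0 eps0.
have [st|nst] := pselect (vi_gap X Y (A *m zy'.2) (- (A^T *m zx'.1)) zx'.1 zy'.2 <= eps).
  exists (Nx + Ny)%N, zx'.1, zy'.2; split=> //; first exact: adaptive_stop st.
  by rewrite (le_trans hN)// ler_wpM2r// lerDl ltW.
have [N [x [y [run Xr Yr gap hN']]]] := hC' _ _ _ eps0 Xx' Yx' Xy' Yy'.
exists (Nx + Ny + N)%N, x, y; split=> //; first exact: adaptive_next run.
by rewrite natrD mulrDl lerD.
Qed.

End Adaptive.

Unset Implicit Arguments.
Theorem theorem4p3 (R : realType) (m n : nat)
    (X : set 'cV[R]_m) (Y : set 'cV[R]_n) (A : 'M[R]_(m, n))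
    (polyX : polytope X) (polyY : polytope Y)
    (X0 : X !=set0) (Y0 : Y !=set0)
    (Z0 : profiles X Y <> [set 0])
    (A0 : A != 0)
    (AX : forall x : 'cV[R]_m, X x -> `|A^T *m x| <= 1)
    (AY : forall y : 'cV[R]_n, Y y -> `|A *m y| <= 1)
    (A1 : forall i j, `|A i j| <= 1)
    (mu_init eta_init : R) (mu0 : 0 < mu_init) (eta0 : 0 < eta_init)
    (x_init : 'cV[R]_m) (y_init : 'cV[R]_n)
    (Xinit : X x_init) (Yinit : Y y_init) :
  (forall eps : R, 0 < eps ->
    exists (N : nat) (x : 'cV[R]_m) (y : 'cV[R]_n),
      [/\ adaptive_asymp_gda A X Y mu_init eta_init x_init y_init eps N x y,
          X x, Y y & nashconv A X Y x y <= eps]) /\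
  (exists2 C : R, 0 < C &
    forall eps : R, 0 < eps -> eps <= 1 / 2 ->
    forall (N : nat) (x : 'cV[R]_m) (y : 'cV[R]_n),
      adaptive_asymp_gda A X Y mu_init eta_init x_init y_init eps N x y ->
      N%:R <= C * ln (1 / eps)).
Proof.
have [C C0 hC] := adaptive_linear polyX X0 polyY Y0 A0 A1 Z0 mu0 1 eta0.
have hrun eps eps0 :=
  hC eps (x_init, y_init) (x_init, y_init) eps0 Xinit Yinit Xinit Yinit.
split=> [eps eps0|].
  have [N [x [y [run Xx Yy gap _]]]] := hrun eps eps0.
  exists N, x, y; split=> //; apply: le_trans gap.
  by apply: nashconv_le => //; [case: polyX|case: polyY].
exists C => // eps eps0 eps2 N x y run.
have [N' [x' [y' [run' _ _ _]]]] := hrun eps eps0.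
by rewrite /log_target min_l// (adaptive_from_det run run').
Qed.
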